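(* Let $W\sim\mathcal W_p(n,\Sigma)$, and let $A,B$ be $p\times p$ symmetric non-random matrices. Then: (i) $\mathrm E[(\mathrm{tr}\,AW)(\mathrm{tr}\,BW)]=n^2\,\mathrm{tr}\Sigma A\,\mathrm{tr}\Sigma B+2n\,\mathrm{tr}\Sigma A\Sigma B.$ (ii) $\mathrm E[\mathrm{tr}\,AWBW]=(n^2+n)\,\mathrm{tr}\Sigma A\Sigma B+n\,\mathrm{tr}\Sigma A\,\mathrm{tr}\Sigma B.$ (iii) $\mathrm E[\mathrm{tr}\,AW^3]=(n^3+3n^2+4n)\,\mathrm{tr}\Sigma^3A+(n^2+n)\,\mathrm{tr}\Sigma^2\,\mathrm{tr}\Sigma A+2n(n+1)\,\mathrm{tr}\Sigma\,\mathrm{tr}\Sigma^2A+n(\mathrm{tr}\Sigma)^2\,\mathrm{tr}\Sigma A.$ (iv) $\mathrm E[(\mathrm{tr}\,AW^2)(\mathrm{tr}\,BW^2)]=n(n^2+n+2)(n+1)\,\mathrm{tr}\Sigma^2A\,\mathrm{tr}\Sigma^2B$ $+(\mathrm{tr}\Sigma)^2\{n^2\,\mathrm{tr}\Sigma A\,\mathrm{tr}\Sigma B+2n\,\mathrm{tr}\Sigma A\Sigma B\}$ $+\mathrm{tr}\Sigma\,\{n(n^2+n+2)\,\mathrm{tr}\Sigma^2A\,\mathrm{tr}\Sigma B+n(n^2+n+2)\,\mathrm{tr}\Sigma A\,\mathrm{tr}\Sigma^2B+8n(n+1)\,\mathrm{tr}\Sigma^2A\Sigma B\}$ $+\mathrm{tr}\Sigma^2\{2n\,\mathrm{tr}\Sigma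 A\,\mathrm{tr}\Sigma B+2n(n+1)\,\mathrm{tr}\Sigma A\Sigma B\}$ $+4n(n+1)^2\,\mathrm{tr}\Sigma^2A\Sigma^2B+4n(n^2+3n+4)\,\mathrm{tr}\Sigma^3A\Sigma B$ $+4n(n+1)(\mathrm{tr}\Sigma^3A\,\mathrm{tr}\Sigma B+\mathrm{tr}\Sigma A\,\mathrm{tr}\Sigma^3B).$ (v) $\mathrm E[\mathrm{tr}\,AW^2BW^2]=2n(n+1)^2\,\mathrm{tr}\Sigma^2A\,\mathrm{tr}\Sigma^2B+n(n^2+3n+4)(n+1)\,\mathrm{tr}\Sigma^2A\Sigma^2B$ $+(\mathrm{tr}\Sigma)^2\{n\,\mathrm{tr}\Sigma A\,\mathrm{tr}\Sigma B+n(n+1)\,\mathrm{tr}\Sigma A\Sigma B\}$ $+\mathrm{tr}\Sigma\,\{2n(n+1)(\mathrm{tr}\Sigma^2A\,\mathrm{tr}\Sigma B+\mathrm{tr}\Sigma A\,\mathrm{tr}\Sigma^2B)+2n(n^2+3n+4)\,\mathrm{tr}\Sigma^2A\Sigma B\}$ $+\mathrm{tr}\Sigma^2\{n(n+1)\,\mathrm{tr}\Sigma A\,\mathrm{tr}\Sigma B+n(n+3)\,\mathrm{tr}\Sigma A\Sigma B\}$ $+n(n^2+3n+4)(\mathrm{tr}\Sigma^3A\,\mathrm{tr}\Sigma B+\mathrm{tr}\Sigma A\,\mathrm{tr}\Sigma^3B)+2n(n^2+7n+8)\,\mathrm{tr}\Sigma^3A\Sigma B.$ (vi) $\mathrm E[(\mathrm{tr}\,AW^3)(\mathrm{tr}\,BW^3)]=(n^2\,\mathrm{tr}\Sigma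 A\,\mathrm{tr}\Sigma B+2n\,\mathrm{tr}\Sigma A\Sigma B)(\mathrm{tr}\Sigma)^4$ $+\{2n(n^2+n+2)(\mathrm{tr}\Sigma B\,\mathrm{tr}\Sigma^2A+\mathrm{tr}\Sigma A\,\mathrm{tr}\Sigma^2B)+16n(n+1)\,\mathrm{tr}\Sigma^2A\Sigma B\}(\mathrm{tr}\Sigma)^3$ $+\{2n(n^2+n+4)\,\mathrm{tr}\Sigma A\,\mathrm{tr}\Sigma B\,\mathrm{tr}\Sigma^2+12n(n+1)\,\mathrm{tr}\Sigma A\Sigma B\,\mathrm{tr}\Sigma^2+4n(n+1)(n^2+n+4)\,\mathrm{tr}\Sigma^2A\,\mathrm{tr}\Sigma^2B$ $\quad+n(n^3+3n^2+24n+20)(\mathrm{tr}\Sigma B\,\mathrm{tr}\Sigma^3A+\mathrm{tr}\Sigma A\,\mathrm{tr}\Sigma^3B)+4n(5n^2+11n+8)\,\mathrm{tr}\Sigma^2A\Sigma^2B+24n(n^2+3n+4)\,\mathrm{tr}\Sigma^3A\Sigma B\}(\mathrm{tr}\Sigma)^2$ $+\{2n(n+1)(n^2+n+10)(\mathrm{tr}\Sigma B\,\mathrm{tr}\Sigma^2\,\mathrm{tr}\Sigma^2A+\mathrm{tr}\Sigma A\,\mathrm{tr}\Sigma^2\,\mathrm{tr}\Sigma^2B)$ $\quad+2n(n^4+4n^3+21n^2+38n+32)\,\mathrm{tr}\Sigma^3B\,\mathrm{tr}\Sigma^2A+16n(n+1)\,\mathrm{tr}\Sigma A\,\mathrm{tr}\Sigma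 B\,\mathrm{tr}\Sigma^3+8n(n^2+3n+4)\,\mathrm{tr}\Sigma^3\,\mathrm{tr}\Sigma A\Sigma B$ $\quad+2n(n^4+4n^3+21n^2+38n+32)\,\mathrm{tr}\Sigma^2B\,\mathrm{tr}\Sigma^3A+16n(2n^2+5n+5)\,\mathrm{tr}\Sigma^2\,\mathrm{tr}\Sigma^2A\Sigma B$ $\quad+4n(7n^2+19n+22)(\mathrm{tr}\Sigma B\,\mathrm{tr}\Sigma^4A+\mathrm{tr}\Sigma A\,\mathrm{tr}\Sigma^4B)+16n(2n^3+9n^2+21n+16)\,\mathrm{tr}\Sigma^3A\Sigma^2B$ $\quad+16n(n^3+6n^2+21n+20)\,\mathrm{tr}\Sigma^4A\Sigma B\}\,\mathrm{tr}\Sigma$ $+n(n+1)(n^2+n+4)\,\mathrm{tr}\Sigma A\,\mathrm{tr}\Sigma B\,(\mathrm{tr}\Sigma^2)^2+4n(5n^2+11n+8)\,\mathrm{tr}\Sigma^2\,\mathrm{tr}\Sigma^2A\,\mathrm{tr}\Sigma^2B$ $+4n(3n^2+7n+6)(\mathrm{tr}\Sigma B\,\mathrm{tr}\Sigma^2A+\mathrm{tr}\Sigma A\,\mathrm{tr}\Sigma^2B)\,\mathrm{tr}\Sigma^3+2n(2n^2+5n+5)(\mathrm{tr}\Sigma^2)^2\,\mathrm{tr}\Sigma A\Sigma B$ $+n(n^4+4n^3+19n^2+36n+36)(\mathrm{tr}\Sigma B\,\mathrm{tr}\Sigma^3A+\mathrm{tr}\Sigma A\,\mathrm{tr}\Sigma^3B)\,\mathrm{tr}\Sigma^2$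 $+n(n^5+6n^4+27n^3+74n^2+156n+120)\,\mathrm{tr}\Sigma^3A\,\mathrm{tr}\Sigma^3B+4n(2n^2+5n+5)\,\mathrm{tr}\Sigma A\,\mathrm{tr}\Sigma B\,\mathrm{tr}\Sigma^4$ $+2n(n^3+6n^2+21n+20)\,\mathrm{tr}\Sigma A\Sigma B\,\mathrm{tr}\Sigma^4+8n(n^3+5n^2+14n+12)\,\mathrm{tr}\Sigma^3\,\mathrm{tr}\Sigma^2A\Sigma B$ $+4n(2n^3+9n^2+21n+16)(2\,\mathrm{tr}\Sigma^2B\,\mathrm{tr}\Sigma^4A+2\,\mathrm{tr}\Sigma^2A\,\mathrm{tr}\Sigma^4B+\mathrm{tr}\Sigma^2\,\mathrm{tr}\Sigma^2A\Sigma^2B)$ $+12n(n^3+5n^2+14n+12)(\mathrm{tr}\Sigma^2\,\mathrm{tr}\Sigma^3A\Sigma B+\mathrm{tr}\Sigma B\,\mathrm{tr}\Sigma^5A+\mathrm{tr}\Sigma A\,\mathrm{tr}\Sigma^5B)$ $+2n(3n^4+20n^3+77n^2+152n+132)\,\mathrm{tr}\Sigma^3A\Sigma^3B+8n(n^4+8n^3+39n^2+80n+64)\,\mathrm{tr}\Sigma^4A\Sigma^2B$ $+4n(n^4+10n^3+65n^2+160n+148)\,\mathrm{tr}\Sigma^5A\Sigma B.$ (vii) $\mathrm E[\mathrm{tr}\,AW^3BW^3]=\{(n^2+n)\,\mathrm{tr}\Sigma A\Sigma B+n\,\mathrm{tr}\Sigma A\,\mathrm{tr}\Sigma B\}(\mathrm{tr}\Sigma)^4$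 $+\{4n(n+1)(\mathrm{tr}\Sigma B\,\mathrm{tr}\Sigma^2A+\mathrm{tr}\Sigma A\,\mathrm{tr}\Sigma^2B)+4n(n^2+3n+4)\,\mathrm{tr}\Sigma^2A\Sigma B\}(\mathrm{tr}\Sigma)^3$ $+\{6n(n+1)\,\mathrm{tr}\Sigma A\,\mathrm{tr}\Sigma B\,\mathrm{tr}\Sigma^2+2n(n^2+4n+7)\,\mathrm{tr}\Sigma A\Sigma B\,\mathrm{tr}\Sigma^2+2n(5n^2+11n+8)\,\mathrm{tr}\Sigma^2A\,\mathrm{tr}\Sigma^2B$ $\quad+6n(n^2+3n+4)(\mathrm{tr}\Sigma B\,\mathrm{tr}\Sigma^3A+\mathrm{tr}\Sigma A\,\mathrm{tr}\Sigma^3B)+2n(2n^3+9n^2+21n+16)\,\mathrm{tr}\Sigma^2A\Sigma^2B$ $\quad+2n(n^3+9n^2+42n+44)\,\mathrm{tr}\Sigma^3A\Sigma B\}(\mathrm{tr}\Sigma)^2$ $+\{4n(2n^2+5n+5)(\mathrm{tr}\Sigma B\,\mathrm{tr}\Sigma^2A+\mathrm{tr}\Sigma A\,\mathrm{tr}\Sigma^2B)\,\mathrm{tr}\Sigma^2+4n(2n^3+9n^2+21n+16)(\mathrm{tr}\Sigma^3B\,\mathrm{tr}\Sigma^2A+\mathrm{tr}\Sigma^2B\,\mathrm{tr}\Sigma^3A)$ $\quad+4n(n^2+3n+4)\,\mathrm{tr}\Sigma A\,\mathrm{tr}\Sigma B\,\mathrm{tr}\Sigma^3+4n(n^2+7n+8)\,\mathrm{tr}\Sigma^3\,\mathrm{tr}\Sigma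 A\Sigma B$ $\quad+4n(n^3+6n^2+21n+20)(\mathrm{tr}\Sigma^2\,\mathrm{tr}\Sigma^2A\Sigma B+\mathrm{tr}\Sigma B\,\mathrm{tr}\Sigma^4A+\mathrm{tr}\Sigma A\,\mathrm{tr}\Sigma^4B)$ $\quad+4n(n^4+8n^3+39n^2+80n+64)\,\mathrm{tr}\Sigma^3A\Sigma^2B+8n(n^3+13n^2+40n+42)\,\mathrm{tr}\Sigma^4A\Sigma B\}\,\mathrm{tr}\Sigma$ $+n(2n^2+5n+5)\,\mathrm{tr}\Sigma A\,\mathrm{tr}\Sigma B\,(\mathrm{tr}\Sigma^2)^2+2n(2n^3+9n^2+21n+16)\,\mathrm{tr}\Sigma^2\,\mathrm{tr}\Sigma^2A\,\mathrm{tr}\Sigma^2B$ $+n(n^3+5n^2+14n+12)\{2(\mathrm{tr}\Sigma B\,\mathrm{tr}\Sigma^2A+\mathrm{tr}\Sigma A\,\mathrm{tr}\Sigma^2B)\,\mathrm{tr}\Sigma^3+3(\mathrm{tr}\Sigma B\,\mathrm{tr}\Sigma^2\,\mathrm{tr}\Sigma^3A+\mathrm{tr}\Sigma A\,\mathrm{tr}\Sigma^2\,\mathrm{tr}\Sigma^3B)\}$ $+n(n^3+4n^2+10n+9)(\mathrm{tr}\Sigma^2)^2\,\mathrm{tr}\Sigma A\Sigma B+n(3n^4+20n^3+77n^2+152n+132)\,\mathrm{tr}\Sigma^3A\,\mathrm{tr}\Sigma^3B$ $+n(n^3+6n^2+21n+20)\,\mathrm{tr}\Sigma A\,\mathrm{tr}\Sigma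 B\,\mathrm{tr}\Sigma^4+n(n^3+14n^2+41n+40)\,\mathrm{tr}\Sigma A\Sigma B\,\mathrm{tr}\Sigma^4$ $+4n(n^3+11n^2+28n+24)\,\mathrm{tr}\Sigma^3\,\mathrm{tr}\Sigma^2A\Sigma B+2n(n^4+8n^3+39n^2+80n+64)(\mathrm{tr}\Sigma^2B\,\mathrm{tr}\Sigma^4A+\mathrm{tr}\Sigma^2A\,\mathrm{tr}\Sigma^4B)$ $+2n(2n^3+19n^2+43n+32)\,\mathrm{tr}\Sigma^2\,\mathrm{tr}\Sigma^2A\Sigma^2B+2n(n^4+7n^3+34n^2+78n+72)\,\mathrm{tr}\Sigma^2\,\mathrm{tr}\Sigma^3A\Sigma B$ $+n(n^4+10n^3+65n^2+160n+148)(\mathrm{tr}\Sigma B\,\mathrm{tr}\Sigma^5A+\mathrm{tr}\Sigma A\,\mathrm{tr}\Sigma^5B)$ $+n(n^5+9n^4+47n^3+151n^2+308n+252)\,\mathrm{tr}\Sigma^3A\Sigma^3B+4n(n^4+16n^3+75n^2+164n+128)\,\mathrm{tr}\Sigma^4A\Sigma^2B$ $+2n(n^4+22n^3+125n^2+328n+292)\,\mathrm{tr}\Sigma^5A\Sigma B.$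
   Context: $\mathcal W_p(n,\Sigma)$ is the Wishart distribution with $n$ degrees of freedom and scale matrix $\Sigma$ (a $p\times p$ covariance matrix), i.e. the law of $\sum_{j=1}^n\boldsymbol y_j\boldsymbol y_j'$ with $\boldsymbol y_1,\dots,\boldsymbol y_n$ i.i.d. $\mathcal N_p(\boldsymbol 0,\Sigma)$. The trace operator applies to the whole matrix product immediately following it, up to the next $\mathrm{tr}$, parenthesis or sum sign: $\mathrm{tr}\Sigma^2A\,\mathrm{tr}\Sigma B$ means $\mathrm{tr}(\Sigma^2A)\cdot\mathrm{tr}(\Sigma B)$, and $\mathrm{tr}\Sigma^3A\Sigma B$ means $\mathrm{tr}(\Sigma^3A\Sigma B)$. *)

(* Defs.v *)
From HB Require Import structures.
From mathcomp Require Import all_boot all_order all_algebra.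
From mathcomp Require Import all_classical all_reals all_analysis.

Set Implicit Arguments.
Unset Strict Implicit.
Unset Printing Implicit Defensive.

Import Order.TTheory GRing.Theory Num.Theory.

Local Open Scope classical_set_scope.
Local Open Scope ring_scope.

(* Matrices carry the product sigma-algebra, generated by the entry maps (as
   the library does for tuples); over the reals it is the Borel sigma-algebra
   of the matrix topology.  In particular a random matrix is an element of
   {RV P >-> 'M[R]_(m, n)}. *)
Definition measure_matrix_display : measure_display -> measure_display.
Proof. by []. Qed.

Definition mx_salgebra d (T : measurableType d) (m n : nat) :
    set (set 'M[T]_(m, n)) :=
  <<s \bigcup_(ij in [set: 'I_m * 'I_n])
        preimage_set_system [set: 'M[T]_(m, n)]
          (fun M : 'M[T]_(m, n) => M ij.1 ij.2) (@measurable d T) >>.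

Section measurable_matrix.
Context d (T : measurableType d) (m n : nat).

Let mx_set0 : mx_salgebra (T := T) (m := m) (n := n) set0.
Proof. exact: sigma_algebra0. Qed.

Let mx_setC (A : set 'M[T]_(m, n)) : mx_salgebra A -> mx_salgebra (~` A).
Proof. exact: sigma_algebraC. Qed.

Let mx_bigcup (F : (set 'M[T]_(m, n))^nat) :
  (forall i, mx_salgebra (F i)) -> mx_salgebra (\bigcup_i F i).
Proof. exact: sigma_algebra_bigcup. Qed.

HB.instance Definition _ := @isMeasurable.Build (measure_matrix_display d)
  'M[T]_(m, n) (@mx_salgebra d T m n) mx_set0 mx_setC mx_bigcup.

End measurable_matrix.

Definition independent_RVs d d' (T : measurableType d) (T' : measurableType d')
    (R : realType) (P : probability T R) (I : finType)
    (X : I -> {RV P >-> T'}) : Prop :=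
  forall (J : {set I}) (U : I -> set T'), (forall i, measurable (U i)) ->
    P (\bigcap_(i in [set` J]) X i @^-1` U i) =
    (\prod_(i in J) P (X i @^-1` U i))%E.

(* Mean m and VARIANCE v, with the point mass at m when v = 0; the library's
   normal_prob is parametrised by the standard deviation and is not a point
   mass when that is 0. *)
Definition normal_law (R : realType) (m v : R) : set R -> \bar R :=
  if v == 0 then \d_m else normal_prob m (Num.sqrt v).

(* N_p(mu, Sigma), Sigma possibly singular: every linear combination t' y of
   the coordinates of y is N(t' mu, t' Sigma t). *)
Definition is_mvnormal d (T : measurableType d) (R : realType)
    (P : probability T R) (p : nat) (mu : 'cV[R]_p) (Sigma : 'M[R]_p)
    (y : {RV P >-> 'cV[R]_p}) : Prop :=
  forall (t : 'cV[R]_p) (U : set R), measurable U ->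
    pushforward P (fun w => (t^T *m y w) 0 0) U =
    normal_law ((t^T *m mu) 0 0) ((t^T *m Sigma *m t) 0 0) U.

Definition is_covariance_mx (R : realType) (p : nat) (Sigma : 'M[R]_p) : Prop :=
  Sigma^T = Sigma /\ forall t : 'cV[R]_p, 0 <= (t^T *m Sigma *m t) 0 0.

(* mu is the Wishart distribution with n degrees of freedom and scale matrix
   Sigma.  The vectors y_j may live on any probability space: their joint law,
   hence mu, does not depend on it. *)
Definition is_wishart (R : realType) (p n : nat) (Sigma : 'M[R]_p)
    (mu : set 'M[R]_p -> \bar R) : Prop :=
  exists (d : measure_display) (T : measurableType d) (P : probability T R)
         (y : 'I_n -> {RV P >-> 'cV[R]_p}),
    [/\ independent_RVs y,
        forall j, is_mvnormal 0 Sigma (y j)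
      & forall U : set 'M[R]_p, measurable U ->
          mu U = pushforward P (fun w => \sum_(j < n) y j w *m (y j w)^T) U].

(* Main.v *)
Require Import Defs.
From HB Require Import structures.
From mathcomp Require Import all_boot all_order all_algebra.
From mathcomp Require Import all_classical all_reals all_analysis.
From mathcomp Require Import measurable_realfun ring lra.

(* By independence and Gaussian integration by parts, the columns y_j satisfy
     E[y_j(a) F(y)] = sum_b Sigma(a, b) E[dF / dy_j(b)]
   for every polynomial F.  Writing W = Y Y^T and applying this to the first
   factor Y of tr(W U) H(W), where U is a word in Sigma, A, B and W and H is a
   product of traces of such words, gives
     E[tr(W U) H] = n E[tr(Sigma U) H]
       + sum_{U = U1 W U2} E[(tr(W U1 Sigma U2^T) + tr(W U1) tr(Sigma U2)) H]
       + sum_{H = tr(V1 W V2) H'}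
           E[(tr(W U Sigma V1^T V2^T) + tr(W U Sigma V2 V1)) H'],
   which has one W less on the right.  Traces of words are invariant under
   rotation and, all letters being symmetric, under reversal, so that equal
   terms can be merged along the way; iterating is a finite computation with
   coefficients polynomial in n. *)

Set Implicit Arguments.
Unset Strict Implicit.
Unset Printing Implicit Defensive.

Import Order.TTheory GRing.Theory Num.Theory.
Import numFieldNormedType.Exports.

Local Open Scope classical_set_scope.
Local Open Scope ring_scope.

(** * Moments of normal laws *)

(** Two obstacles shape the proof. What is given is the law of each linear form t' y, a normal law
    or a point mass, for which E[X^(k+1)] = v k E[X^(k-1)] with v the variance. As this holds for
    every t, replacing t by t + x s yields an equality of polynomials in x, and its linear
    coefficients are identities between mixed moments: polarisation takes the place of the joint
    density. The second obstacle is size: with six factors W the recursion branches far beyond what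
    can be written out. It is therefore run as a program on words coded by lists of naturals, and
    proved sound for any functional on words that obeys the recursion and respects the symmetries of
    traces. What remains of each formula is a polynomial identity in n and in finitely many traces
    treated as indeterminates. The relation tr(Sigma^i A Sigma^j B) = tr(Sigma^j A Sigma^i B),
    coming from rotation and reversal, is what makes so few traces suffice. *)

Section gaussian_moments.
Context {R : realType} (s : R).
Hypothesis s0 : s != 0.
Local Notation mu := (@lebesgue_measure R).
Local Notation pdf := (normal_pdf 0 s).

(** Trades an absolute value, awkward for odd [k], for a power of [x ^+ 2], the quantity that
    appears in the Gaussian exponent. *)
Lemma normr_expr_le_1D (k : nat) (x : R) : `|x| ^+ k <= 1 + (x ^+ 2) ^+ k.
Proof.
rewrite -exprM mulnC exprM -[X in _ <= _ + X](real_normK) ?num_real// normrX.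
set y := `|x| ^+ k.
have y0 : 0 <= y by exact: exprn_ge0.
have [y1|/ltW y1] := leP y 1; first by rewrite (le_trans y1)// lerDl sqr_ge0.
by rewrite (le_trans (ler_eXnr (isT : 0 < 2)%N y1))// lerDr.
Qed.

(** Half of the exponent absorbs the power: with y = x^2 / (4 s^2) the Gaussian is exp(-y) exp(-y).
    One factor bounds x^(2k) = (4 s^2 y)^k by (4 s^2)^k k!, because y^k / k! <= exp(y); the other is
    the Gaussian of variance 2 s^2. *)
Lemma expr_normal_fun_le (k : nat) : exists2 C : R, 0 <= C &
  forall x, `|x| ^+ k * normal_fun 0 s x <= C * normal_fun 0 (s * Num.sqrt 2) x.
Proof.
have s2 : 0 < s ^+ 2 by rewrite exprn_even_gt0.
exists (1 + (s ^+ 2 *+ 4) ^+ k * (k`!)%:R).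
  by rewrite addr_ge0// mulr_ge0// exprn_ge0// mulrn_wge0// ltW.
move=> x; rewrite /normal_fun !subr0 exprMn sqr_sqrtr// ?ler0n//.
set y := x ^+ 2 / (s ^+ 2 *+ 4).
have y0 : 0 <= y by rewrite divr_ge0 ?sqr_ge0// mulrn_wge0// ltW.
have -> : - x ^+ 2 / (s ^+ 2 *+ 2) = - y - y.
  by rewrite /y; field.
have -> : - x ^+ 2 / (s ^+ 2 * 2 *+ 2) = - y.
  by rewrite /y; field.
rewrite expRD mulrA ler_wpM2r ?expR_ge0//.
rewrite (le_trans (ler_wpM2r (expR_ge0 _) (normr_expr_le_1D k x)))//.
rewrite mulrDl mul1r lerD//; first by rewrite expR_le1 oppr_le0.
have -> : x ^+ 2 = s ^+ 2 *+ 4 * y by rewrite /y; field.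
rewrite exprMn -mulrA ler_wpM2l ?exprn_ge0 ?mulrn_wge0 ?(ltW s2)//.
rewrite expRN ler_pdivrMr ?expR_gt0//.
case: k => [|k]; first by rewrite expr0 fact0 mul1r -[leLHS]expR0 ler_expR.
have h := expR_ge1Dxn k y0.
rewrite -ler_pdivrMl ?ltr0n ?fact_gt0// mulrC (le_trans _ h)// lerDr.
exact: ler01.
Qed.

Lemma measurable_expr_normal_pdf (k : nat) :
  measurable_fun setT (fun x : R => x ^+ k * pdf x).
Proof.
apply: measurable_funM; last exact: measurable_normal_pdf.
exact: exprn_measurable.
Qed.

Lemma integrable_expr_normal_pdf (k : nat) :
  mu.-integrable setT (fun x : R => (x ^+ k * pdf x)%:E).
Proof.
have [C C0 hC] := expr_normal_fun_le k.
have t0 : s * Num.sqrt 2 != 0.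
  by rewrite mulf_neq0// gt_eqF// sqrtr_gt0.
(* The quotient of the peaks passes from the unnormalised bound to the densities of standard
   deviations [s] and [s * Num.sqrt 2]. *)
pose D := normal_peak s * C / normal_peak (s * Num.sqrt 2).
apply: (@le_integrable _ _ _ mu setT measurableT _
   (fun x => (D%:E * (normal_pdf 0 (s * Num.sqrt 2) x)%:E)%E)).
- apply/measurable_EFinP; exact: measurable_expr_normal_pdf.
- move=> x _; rewrite -EFinM !abse_EFin lee_fin.
  rewrite [leRHS]ger0_norm; last first.
    by rewrite mulr_ge0 ?normal_pdf_ge0// divr_ge0 ?normal_peak_ge0// mulr_ge0 ?normal_peak_ge0.
  rewrite normrM normrX (ger0_norm (normal_pdf_ge0 _ _ _)) !normal_pdfE//.
  rewrite mulrCA /D.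
  have -> : normal_peak s * C / normal_peak (s * Num.sqrt 2) *
     (normal_peak (s * Num.sqrt 2) * normal_fun 0 (s * Num.sqrt 2) x) =
     normal_peak s * (C * normal_fun 0 (s * Num.sqrt 2) x).
    by field; rewrite gt_eqF// normal_peak_gt0.
  by rewrite ler_wpM2l// normal_peak_ge0.
- apply: integrableZl => //; exact: integrable_normal_pdf.
Qed.

(** Since s^2 pdf' = - x pdf, the Stein integrand has the explicit antiderivative s^2 x^k pdf, so
    integration by parts reduces to the fundamental theorem of calculus. *)
Lemma is_derive_expr_normal_pdf (k : nat) (x : R) :
  is_derive x (1 : R) (fun x : R => s ^+ 2 * (x ^+ k * pdf x) : R)
    ((s ^+ 2 * k%:R * x ^+ k.-1 - x ^+ k.+1) * pdf x).
Proof.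
rewrite normal_pdfE// /normal_fun.
have hX : is_derive x (1 : R) (fun y : R => y ^+ k) (k%:R * x ^+ k.-1).
  have := @is_deriveX R R (@id R) k x 1 1 _.
  rewrite exprfctE /= => /(_ (is_derive_id _ _)) h.
  by apply: (is_derive_eq h); rewrite /GRing.scale /= mulr1.
have hE : is_derive x (1 : R) (fun y : R => - y ^+ 2 / (s ^+ 2 *+ 2)) (- x / s ^+ 2).
  have := @is_deriveX R R (@id R) 2 x 1 1 _.
  rewrite exprfctE /= => /(_ (is_derive_id _ _)) h.
  have {}h := is_deriveZ (- (s ^+ 2 *+ 2)^-1) h.
  have -> : (fun y : R => - y ^+ 2 / (s ^+ 2 *+ 2)) =
      (- (s ^+ 2 *+ 2)^-1 \*: (fun y : R => y ^+ 2)).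
    by apply/funext => y /=; rewrite /GRing.scale /= mulNr [in RHS]mulNr mulrC.
  by apply: (is_derive_eq h); rewrite /GRing.scale /= expr1 mulr1; field.
have hG := @is_derive1_comp R _ _ x _ _ (is_derive_expR _) hE.
have h := is_deriveZ (s ^+ 2 * normal_peak s) (is_deriveM hX hG).
rewrite [X in is_derive _ _ X _](_ : _ = (s ^+ 2 * normal_peak s \*:
    ((fun y : R => y ^+ k) * (expR \o (fun y : R => - y ^+ 2 / (s ^+ 2 *+ 2)))))); last first.
  apply/funext => y /=; rewrite /GRing.scale /= subr0.
  by rewrite -[(_ * _) y]/(y ^+ k * expR (- y ^+ 2 / (s ^+ 2 *+ 2))); ring.
apply: (is_derive_eq h); rewrite /GRing.scale /= subr0 [x ^+ k.+1]exprS.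
set E := expR _; set p := normal_peak s; set a := x ^+ k.-1; set b := x ^+ k.
clearbody E p a b.
by field.
Qed.

(** The bound for the power [k.+1] leaves one factor 1/x to spare, whence the comparison with the
    harmonic sequence. *)
Lemma expr_normal_pdf_cvg0 (k : nat) :
  (fun n : nat => n.+1%:R ^+ k * pdf n.+1%:R) @ \oo --> (0 : R).
Proof.
have [C C0 hC] := expr_normal_fun_le k.+1.
apply: (@squeeze_cvgr _ _ _ _ (cst 0) (fun n => normal_peak s * C * harmonic n)).
- apply: nearW => n; rewrite mulr_ge0 ?exprn_ge0 ?normal_pdf_ge0//=.
  have := hC n.+1%:R; rewrite ger0_norm// exprSr -mulrA => h.
  rewrite normal_pdfE// mulrCA -mulrA ler_wpM2l ?normal_peak_ge0//.
  rewrite ler_pdivlMr ?ltr0n// mulrC mulrCA (le_trans h)//.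
  by rewrite ler_piMr// /normal_fun expR_le1 mulNr oppr_le0 divr_ge0 ?sqr_ge0// mulrn_wge0 ?sqr_ge0.
- exact: cvg_cst.
- by rewrite -[X in _ --> X](mulr0 (normal_peak s * C)); apply: cvgMr; exact: cvg_harmonic.
Qed.

Let f k (x : R) : R := (s ^+ 2 * k%:R * x ^+ k.-1 - x ^+ k.+1) * pdf x.
Let F k (x : R) : R := s ^+ 2 * (x ^+ k * pdf x).

Let continuous_f k : continuous (f k).
Proof.
move=> x; apply: cvgM; last exact: continuous_normal_pdf.
apply: cvgB; last exact: exprn_continuous.
by apply: cvgM; [exact: cvg_cst | exact: exprn_continuous].
Qed.

Let integrable_f k : mu.-integrable setT (fun x => (f k x)%:E).
Proof.
rewrite (_ : (fun x => _) = (fun x => (s ^+ 2 * k%:R)%:E * (x ^+ k.-1 * pdf x)%:E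
   - (x ^+ k.+1 * pdf x)%:E)%E); last first.
  by apply/funext => x; rewrite -EFinM -EFinB /f mulrBl mulrA.
apply: integrableB => //; last exact: integrable_expr_normal_pdf.
by apply: integrableZl => //; exact: integrable_expr_normal_pdf.
Qed.

Let integral_f_itv k (n : nat) :
  (\int[mu]_(x in `[(- n.+1%:R)%R, n.+1%:R%R]) (f k x)%:E =
   (F k n.+1%:R%R - F k (- n.+1%:R)%R)%R%:E)%E.
Proof.
have dF x : derivable (F k) x 1.
  by have [] := is_derive_expr_normal_pdf k x.
have cF : continuous (F k).
  by move=> x; apply: differentiable_continuous; exact/derivable1_diffP.
rewrite EFinB; apply: continuous_FTC2.
- by rewrite gtrN// ltr0n.
- exact/continuous_subspaceT/continuous_f.
- split => //.
  + by apply: cvg_at_right_filter; exact: cF.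
  + by apply: cvg_at_left_filter; exact: cF.
- move=> x _; rewrite derive1E.
  by have [_ ->] := is_derive_expr_normal_pdf k x.
Qed.

Let cvg_F k : (fun n : nat => (F k n.+1%:R - F k (- n.+1%:R))%:E) @ \oo --> (0%E : \bar R).
Proof.
apply: cvg_EFin; first exact: nearW.
have -> : (fine \o (fun n : nat => (F k n.+1%:R - F k (- n.+1%:R))%:E)) =
  (fun n : nat => s ^+ 2 * (1 - (-1) ^+ k) * (n.+1%:R ^+ k * pdf n.+1%:R)).
  apply/funext => n /=; rewrite /F (exprNn n.+1%:R).
  have -> : pdf (- n.+1%:R) = pdf n.+1%:R.
    by rewrite normal_pdfE// /normal_fun !subr0 sqrrN.
  by set e := (-1) ^+ k; set a := n.+1%:R ^+ k; set b := pdf _; ring.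
rewrite -[X in _ --> X](mulr0 (s ^+ 2 * (1 - (-1) ^+ k))).
by apply: cvgMr; exact: expr_normal_pdf_cvg0.
Qed.

(** The integrals over the intervals [-(n+1), n+1] are differences of boundary values, which vanish
    in the limit; dominated convergence identifies that limit with the full integral. For [k = 0]
    the default [k.-1 = 0] is harmless, its coefficient being 0, and the statement says that the
    mean is 0. *)
Lemma integral_stein_normal_pdf (k : nat) :
  (\int[mu]_x ((s ^+ 2 * k%:R * x ^+ k.-1 - x ^+ k.+1) * pdf x)%R%:E = 0)%E.
Proof.
pose f_ n := (EFin \o f k) \_ `[- n.+1%:R, n.+1%:R].
have : (\int[mu]_x f_ n x)%E @[n --> \oo] --> (\int[mu]_x (f k x)%:E)%E.
  apply: (@dominated_cvg _ _ _ mu setT measurableT f_ _ (abse \o (EFin \o f k))) => //.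
  - move=> n; apply/(measurable_restrictT _ _).1 => //.
    apply: measurable_funTS; exact: (measurable_int _ (integrable_f k)).
  - move=> x _; apply: cvg_near_cst; near=> n.
    rewrite /f_ patchE ifT// inE/= in_itv/= -ler_norml.
    near: n; exists (Num.truncn `|x|) => // n /= hn.
    by rewrite ltW// (lt_le_trans (truncnS_gt _))// ler_nat.
  - by apply: integrable_abse => //; exact: integrable_f.
  - by move=> n x _; rewrite /f_ patchE; case: ifP => //= _; rewrite normr0 lee_fin.
rewrite (_ : (fun n => _) = (fun n => (F k n.+1%:R - F k (- n.+1%:R))%:E)); last first.
  by apply/funext => n; rewrite -integral_f_itv /f_ -integral_mkcond.
move=> h; exact: (cvg_unique _ h (cvg_F k)).
Unshelve. all: by end_near. Qed.

End gaussian_moments.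

(** * Integrals against a normal law, and their transfer to random variables *)

Section normal_prob_integral.
Context {R : realType} (m s : R).
Local Notation mu := (@lebesgue_measure R).
Local Notation nu := (normal_prob m s).

(** [normal_prob] integrates its density over sets, so that density and the Radon-Nikodym derivative
    have the same integral over every measurable set and agree almost everywhere; change of
    variables for the derivative then gives the claim. *)
Lemma ge0_integral_normal_prob (f : R -> \bar R) :
  measurable_fun setT f -> (forall x, 0 <= f x)%E ->
  (\int[nu]_x f x = \int[mu]_x (f x * (normal_pdf m s x)%:E))%E.
Proof.
move=> mf f0; have dom := normal_prob_dominates m s.
rewrite -(Radon_Nikodym_SigmaFinite.change_of_variables dom)//.
have iRN := Radon_Nikodym_SigmaFinite.f_integrable dom.
apply: ae_eq_integral => //.
- apply: emeasurable_funM => //; exact: measurable_int iRN.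
- apply: emeasurable_funM => //.
  by apply/measurable_EFinP; exact: measurable_normal_pdf.
- apply: ae_eqe_mul2l; apply: integral_ae_eq => //.
  + by apply/measurable_EFinP; exact: measurable_normal_pdf.
  + by move=> E _ mE; rewrite -Radon_Nikodym_SigmaFinite.f_integral.
Qed.

Lemma integrable_normal_prob (f : R -> R) : measurable_fun setT f ->
  mu.-integrable setT (fun x => (f x * normal_pdf m s x)%:E) ->
  nu.-integrable setT (EFin \o f).
Proof.
move=> mf /integrableP[_ h]; apply/integrableP; split; first exact/measurable_EFinP.
have mabs : measurable_fun setT (fun x => `|(f x)%:E|%E).
  by apply: measurableT_comp => //; exact/measurable_EFinP.
rewrite (ge0_integral_normal_prob mabs)//.
under eq_integral do rewrite /= -(ger0_norm (normal_pdf_ge0 _ _ _)) -EFinM -normrM.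
exact: h.
Qed.

Lemma integral_normal_prob (f : R -> R) : measurable_fun setT f ->
  mu.-integrable setT (fun x => (f x * normal_pdf m s x)%:E) ->
  (\int[nu]_x (f x)%:E = \int[mu]_x (f x * normal_pdf m s x)%:E)%E.
Proof.
move=> mf intf; have dom := normal_prob_dominates m s.
rewrite -(Radon_Nikodym_change_of_variables dom)//=; last exact: integrable_normal_prob.
apply: ae_eq_integral => //.
- by apply: emeasurable_funM => //; exact/measurable_EFinP.
- exact: measurable_int intf.
- under [X in ae_eq _ _ _ X]eq_fun do rewrite EFinM.
  apply: ae_eqe_mul2l; apply: integral_ae_eq => //.
  + exact: Radon_Nikodym_integrable.
  + by apply/measurable_EFinP; exact: measurable_normal_pdf.
  + by move=> E _ mE; rewrite -Radon_Nikodym_integral.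
Qed.

End normal_prob_integral.

Section transfer.
Context {R : realType} d d' (T : measurableType d) (T' : measurableType d')
  (P : probability T R).

Variables (X : T -> T') (mX : measurable_fun setT X) (nu : {measure set T' -> \bar R}).
Hypothesis hX : forall U, measurable U -> pushforward P X U = nu U.
Variables (f : T' -> R) (mf : measurable_fun setT f).
Hypothesis intf : nu.-integrable setT (EFin \o f).

(** Agreement of the law of [X] with [nu] on measurable sets is all that an integral sees. This lets
    [normal_law], a mere set function, be replaced by a Dirac measure or by [normal_prob] once the
    case is known. *)
Lemma integrable_law : P.-integrable setT (fun w => (f (X w))%:E).
Proof.
move/integrableP : intf => [_ h]; apply/integrableP; split.
  by apply/measurable_EFinP; exact: measurableT_comp.
have mabs : measurable_fun setT (fun x => `|(f x)%:E|%E).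
  by apply: measurableT_comp => //; exact/measurable_EFinP.
rewrite -[ltLHS](ge0_integral_pushforward mX P measurableT mabs)//.
by rewrite (@eq_measure_integral _ _ _ _ nu)// => A mA _; exact: hX.
Qed.

Lemma integral_law : (\int[P]_w (f (X w))%:E = \int[nu]_x (f x)%:E)%E.
Proof.
have mEf : measurable_fun setT (EFin \o f) by exact/measurable_EFinP.
rewrite -[LHS](@integral_pushforward _ _ _ _ _ _ mX P setT _ mEf integrable_law measurableT).
by apply: eq_measure_integral => A mA _; exact: hX.
Qed.

End transfer.

Lemma integrable_dirac {R : realType} d (T : measurableType d) (a : T) (f : T -> R) :
  measurable_fun setT f -> (\d_a : {measure set T -> \bar R}).-integrable setT (EFin \o f).
Proof.
move=> mf; apply/integrableP; split; first exact/measurable_EFinP.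
have mabs : measurable_fun setT (fun x => `|(f x)%:E|%E).
  by apply: measurableT_comp => //; exact/measurable_EFinP.
by rewrite (integral_dirac _ _ mabs)// diracT mul1e ltry.
Qed.

Section normal_law_moments.
Context {R : realType} d (T : measurableType d) (P : probability T R).
Variables (X : T -> R) (mX : measurable_fun setT X) (v : R).
Hypothesis v0 : 0 <= v.
Hypothesis hX : forall U : set R, measurable U -> pushforward P X U = normal_law 0 v U.

Let mexp k : measurable_fun setT (fun x : R => x ^+ k).
Proof. exact: exprn_measurable. Qed.

Let mstein k : measurable_fun setT (fun x : R => v * k%:R * x ^+ k.-1 - x ^+ k.+1).
Proof. by apply: measurable_funB => //; exact: measurable_funM. Qed.

Lemma normal_law_integrable_expr k : P.-integrable setT (fun w => (X w ^+ k)%:E).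
Proof.
move: hX; rewrite /normal_law; have [v1 hX'|v1 hX'] := eqVneq v 0.
  apply: (@integrable_law _ _ _ _ _ P _ mX (\d_(0 : R)) _ (fun x => x ^+ k)) => //.
  exact: integrable_dirac.
have s0 : Num.sqrt v != 0 by rewrite sqrtr_eq0 -ltNge lt_def v1.
apply: (@integrable_law _ _ _ _ (measurableTypeR R) P _ mX
  (normal_prob 0 (Num.sqrt v)) _ (fun x => x ^+ k)) => //.
by apply: integrable_normal_prob => //; exact: integrable_expr_normal_pdf.
Qed.

(** Written in terms of the variance, the identity covers the degenerate case too: at the point mass
    both terms vanish, the first by v = 0 and the second because [k.+1] is positive. *)
Lemma normal_law_stein k :
  (\int[P]_w (v * k%:R * X w ^+ k.-1 - X w ^+ k.+1)%R%:E = 0)%E.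
Proof.
pose f (x : R) := v * k%:R * x ^+ k.-1 - x ^+ k.+1.
move: hX; rewrite /normal_law; have [v1 hX'|v1 hX'] := eqVneq v 0.
  rewrite (@integral_law _ _ _ _ _ P _ mX (\d_(0 : R)) hX' f (mstein k)
    (integrable_dirac _ (mstein k))).
  have mEf : measurable_fun setT (EFin \o f).
    by apply/measurable_EFinP; exact: mstein.
  rewrite (integral_dirac _ _ mEf)//=.
  by rewrite /f v1 !mul0r exprS mul0r subr0 mule0.
have s0 : Num.sqrt v != 0 by rewrite sqrtr_eq0 -ltNge lt_def v1.
have intf : lebesgue_measure.-integrable setT (fun x => (f x * normal_pdf 0 (Num.sqrt v) x)%:E).
  rewrite (_ : (fun x => _) = (fun x => (v * k%:R)%:E * (x ^+ k.-1 * normal_pdf 0 (Num.sqrt v) x)%:E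
   - (x ^+ k.+1 * normal_pdf 0 (Num.sqrt v) x)%:E)%E); last first.
    by apply/funext => x; rewrite -EFinM -EFinB /f mulrBl mulrA.
  apply: integrableB => //; last exact: integrable_expr_normal_pdf.
  by apply: integrableZl => //; exact: integrable_expr_normal_pdf.
rewrite (@integral_law _ _ _ _ (measurableTypeR R) P _ mX (normal_prob 0 (Num.sqrt v))
  hX' f (mstein k) (integrable_normal_prob (mstein k) intf)).
rewrite (integral_normal_prob (mstein k) intf).
by have := integral_stein_normal_pdf s0 k; rewrite sqr_sqrtr.
Qed.

End normal_law_moments.

(** * Real random variables with moments of all orders *)

Section moments.
Context {R : realType} d (T : measurableType d) (P : probability T R).
Implicit Types f g : T -> R.

(** Integrability is not stable under products; integrability of all powers is, so these functions
    form an algebra and integrability of polynomial expressions follows by closure. *)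
Definition moments f := measurable_fun setT f /\
  forall k, P.-integrable setT (fun w => (f w ^+ k)%:E).

Lemma moments_measurable f : moments f -> measurable_fun setT f.
Proof. by case. Qed.

Lemma moments_integrable f : moments f -> P.-integrable setT (EFin \o f).
Proof. by move=> [_ /(_ 1%N)]. Qed.

(** From |a b| <= a^2 + b^2 with a, b the two powers, whose squares are again powers of [f] and
    [g]. *)
Lemma moments_integrableM f g i j : moments f -> moments g ->
  P.-integrable setT (fun w => (f w ^+ i * g w ^+ j)%:E).
Proof.
move=> [mf hf] [mg hg].
have h : P.-integrable setT
    (fun w => ((f w ^+ (2 * i))%:E + (g w ^+ (2 * j))%:E)%E) by exact: integrableD.
apply: (le_integrable _ _ _ h) => //.
  by apply/measurable_EFinP; apply: measurable_funM; exact: measurable_funX.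
move=> w _; rewrite -EFinD !abse_EFin lee_fin mulnC exprM (mulnC 2%N) exprM.
set a := f w ^+ i; set b := g w ^+ j.
rewrite normrM [leRHS]ger0_norm ?addr_ge0 ?sqr_ge0//.
rewrite -(real_normK (num_real a)) -(real_normK (num_real b)).
have : 0 <= (`|a| - `|b|) ^+ 2 by exact: sqr_ge0.
have : 0 <= `|a| * `|b| by rewrite mulr_ge0.
by nra.
Qed.

Lemma moments_cst (c : R) : moments (fun=> c).
Proof.
split=> [|k]; first exact: measurable_cst.
exact: finite_measure_integrable_cst.
Qed.

Lemma momentsM f g : moments f -> moments g -> moments (fun w => f w * g w).
Proof.
move=> hf hg; split; first by apply: measurable_funM; [case: hf|case: hg].
move=> k; under eq_fun do rewrite exprMn.
exact: moments_integrableM.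
Qed.

Lemma momentsD f g : moments f -> moments g -> moments (fun w => f w + g w).
Proof.
move=> hf hg; split; first by apply: measurable_funD; [case: hf|case: hg].
move=> k; under eq_fun do rewrite exprDn -sumEFin.
apply: integrable_sum => // i _.
apply: (eq_integrable _ (fun w => ('C(k, i)%:R)%:E * (f w ^+ (k - i) * g w ^+ i)%:E)%E) => //.
  by move=> w _; rewrite -EFinM mulr_natl.
by apply: integrableZl => //; exact: moments_integrableM.
Qed.

Lemma momentsZ (c : R) f : moments f -> moments (fun w => c * f w).
Proof. by move=> hf; apply: momentsM => //; exact: moments_cst. Qed.

Lemma momentsN f : moments f -> moments (fun w => - f w).
Proof. by move=> hf; under eq_fun do rewrite -mulN1r; exact: momentsZ. Qed.

Lemma momentsX f k : moments f -> moments (fun w => f w ^+ k).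
Proof.
move=> hf; elim: k => [|k IH]; first by under eq_fun do rewrite expr0; exact: moments_cst.
by under eq_fun do rewrite exprS; exact: momentsM.
Qed.

Lemma moments_sum (I : Type) (r : seq I) (Q : pred I) (F : I -> T -> R) :
  (forall i, Q i -> moments (F i)) -> moments (fun w => \sum_(i <- r | Q i) F i w).
Proof.
move=> hF; elim: r => [|i r IH].
  by under eq_fun do rewrite big_nil; exact: moments_cst.
have [Qi|Qi] := boolP (Q i); under eq_fun do rewrite big_cons ?Qi ?(negPf Qi); last exact: IH.
by apply: momentsD => //; exact: hF.
Qed.

Lemma moments_prod (I : Type) (r : seq I) (Q : pred I) (F : I -> T -> R) :
  (forall i, Q i -> moments (F i)) -> moments (fun w => \prod_(i <- r | Q i) F i w).
Proof.
move=> hF; elim: r => [|i r IH].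
  by under eq_fun do rewrite big_nil; exact: moments_cst.
have [Qi|Qi] := boolP (Q i); under eq_fun do rewrite big_cons ?Qi ?(negPf Qi); last exact: IH.
by apply: momentsM => //; exact: hF.
Qed.

Lemma moments_bounded f (M : R) : measurable_fun setT f ->
  (forall w, `|f w| <= M) -> moments f.
Proof.
move=> mf hM; split=> // k.
have h : P.-integrable setT (fun w => (M ^+ k)%:E).
  exact: finite_measure_integrable_cst.
apply: (le_integrable _ _ _ h) => //.
  by apply/measurable_EFinP; exact: measurable_funX.
move=> w _; rewrite !abse_EFin lee_fin normrX (le_trans _ (ler_norm _))//.
by rewrite lerXn2r ?nnegrE//; exact: le_trans (hM w).
Qed.

(** Real-valued, so that identities between means live in a ring; under [moments] it is the
    expectation, by [expectation_mean]. *)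
Definition Rmean f : R := (\int[P]_w f w)%R.

Lemma mean_cst (c : R) : Rmean (fun=> c) = c.
Proof. by rewrite /Rmean /Rintegral integral_cst//= probability_setT mule1. Qed.

Lemma meanD f g : moments f -> moments g ->
  Rmean (fun w => f w + g w) = Rmean f + Rmean g.
Proof. by move=> hf hg; rewrite /Rmean RintegralD//; exact: moments_integrable. Qed.

Lemma meanZ c f : moments f -> Rmean (fun w => c * f w) = c * Rmean f.
Proof. by move=> hf; rewrite /Rmean RintegralZl//; exact: moments_integrable. Qed.

Lemma meanB f g : moments f -> moments g ->
  Rmean (fun w => f w - g w) = Rmean f - Rmean g.
Proof. by move=> hf hg; rewrite /Rmean RintegralB//; exact: moments_integrable. Qed.

Lemma mean_sum (I : Type) (r : seq I) (Q : pred I) (F : I -> T -> R) :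
  (forall i, Q i -> moments (F i)) ->
  Rmean (fun w => \sum_(i <- r | Q i) F i w) = \sum_(i <- r | Q i) Rmean (F i).
Proof.
move=> hF; elim: r => [|i r IH].
  by under eq_fun do rewrite big_nil; rewrite mean_cst big_nil.
rewrite big_cons; have [Qi|Qi] := boolP (Q i);
  under eq_fun do rewrite big_cons ?Qi ?(negPf Qi); last exact: IH.
by rewrite meanD ?IH//; [exact: hF|exact: moments_sum].
Qed.

Lemma expectation_mean f : moments f -> ('E_P[f] = (Rmean f)%:E)%E.
Proof.
move=> hf; rewrite unlock /Rmean /Rintegral fineK//.
by apply: integrable_fin_num => //; exact: moments_integrable.
Qed.

End moments.

(** * Integration by parts for a Gaussian vector *)

Lemma measurable_mx_entry (R : realType) (m n : nat) (i : 'I_m) (j : 'I_n) :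
  measurable_fun setT (fun M : 'M[R]_(m, n) => M i j).
Proof.
move=> _ U mU; rewrite setTI; apply: sub_sigma_algebra.
by exists (i, j) => //; exists U => //; rewrite setTI.
Qed.

(** The naturals are pairwise distinct in [R], hence supply more roots than a nonzero difference can
    have. This licenses the comparison of coefficients in every polarisation below. *)
Lemma eq_horner_poly (R : numDomainType) (r s : {poly R}) :
  (forall x, r.[x] = s.[x]) -> r = s.
Proof.
move=> h; apply/eqP; rewrite -subr_eq0; apply/eqP.
apply: (@roots_geq_poly_eq0 _ _ [seq i%:R | i <- iota 0 (size (r - s))]).
- by apply/allP => x _; rewrite /root hornerD hornerN h subrr.
- by rewrite map_inj_uniq ?iota_uniq// => a b /eqP; rewrite eqr_nat => /eqP.
- by rewrite size_map size_iota.
Qed.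

Section mean_poly.
Context {R : realType} d (T : measurableType d) (P : probability T R).
Local Notation mean := (Rmean P).
Local Notation moments := (moments P).

(** The binomial expansion of E[g (a + x u)^m] as a formal polynomial in x. Its coefficient of
    degree 1 has one factor [a] replaced by [u], which is how mixed moments are extracted. *)
Definition mean_poly (g a u : T -> R) m : {poly R} :=
  \poly_(i < m.+1) (mean (fun w => g w * a w ^+ (m - i) * u w ^+ i) *+ 'C(m, i)).

Lemma horner_mean_poly g a u m x : moments g -> moments a -> moments u ->
  (mean_poly g a u m).[x] = mean (fun w => g w * (a w + x * u w) ^+ m).
Proof.
move=> hg ha hu; rewrite horner_poly.
have hi i : moments (fun w => g w * a w ^+ (m - i) * u w ^+ i).
  by apply: momentsM; [apply: momentsM => //|]; exact: momentsX.
transitivity (mean (fun w => \sum_(i < m.+1)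
    ('C(m, i)%:R * x ^+ i) * (g w * a w ^+ (m - i) * u w ^+ i))).
  rewrite mean_sum; last by move=> i _; apply: momentsZ.
  apply: eq_bigr => i _; rewrite meanZ//.
  by rewrite -[mean _ *+ _]mulr_natl mulrAC.
congr (mean _); apply/funext => w; rewrite exprDn big_distrr/=.
apply: eq_bigr => i _; rewrite exprMn -mulr_natl.
set c := 'C(m, i)%:R; set e := x ^+ i; set f := a w ^+ _; set h := u w ^+ i; ring.
Qed.

Lemma mean_poly0 g a u m : (mean_poly g a u m)`_0 = mean (fun w => g w * a w ^+ m).
Proof.
rewrite coef_poly/= bin0 subn0; congr (mean _).
by apply/funext => w; rewrite expr0 mulr1.
Qed.

Lemma mean_poly1 g a u m :
  (mean_poly g a u m)`_1 = m%:R * mean (fun w => g w * a w ^+ m.-1 * u w).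
Proof.
rewrite coef_poly; case: m => [|m]; first by rewrite mul0r.
by rewrite ltnS ltn0Sn bin1 mulr_natl subn1.
Qed.

End mean_poly.

Section mvnormal.
Context {R : realType} d (T : measurableType d) (P : probability T R).
Context (p : nat) (Sigma : 'M[R]_p) (y : {RV P >-> 'cV[R]_p}).
Hypothesis hS : is_covariance_mx Sigma.
Hypothesis hy : is_mvnormal 0 Sigma y.
Local Notation mean := (Rmean P).
Local Notation moments := (moments P).

Let L (t : 'cV[R]_p) (w : T) : R := (t^T *m y w) 0 0.
Let q (s t : 'cV[R]_p) : R := (s^T *m Sigma *m t) 0 0.

Let LD s t x w : L (s + x *: t) w = L s w + x * L t w.
Proof. by rewrite /L linearD linearZ/= mulmxDl -scalemxAl !mxE. Qed.

Let qC s t : q s t = q t s.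
Proof.
have [St _] := hS; rewrite /q -[in LHS]St.
transitivity ((t^T *m Sigma *m s)^T 0 0); last by rewrite mxE.
by rewrite !trmx_mul trmxK mulmxA.
Qed.

Let qDr s t u x : q s (t + x *: u) = q s t + x * q s u.
Proof. by rewrite /q mulmxDr -scalemxAr !mxE. Qed.

Let qDl s t u x : q (t + x *: u) s = q t s + x * q u s.
Proof. by rewrite qC qDr (qC t) (qC u). Qed.

Let measurable_L t : measurable_fun setT (L t).
Proof.
rewrite (_ : L t = (fun w => \sum_i t i 0 * y w i 0)); last first.
  by apply/funext => w; rewrite /L mxE; apply: eq_bigr => i _; rewrite mxE.
apply: measurable_sum => i; apply: measurable_funM => //.
by apply: (measurableT_comp (measurable_mx_entry i 0)).
Qed.

Let L_law t (U : set R) : measurable U -> pushforward P (L t) U = normal_law 0 (q t t) U.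
Proof.
move=> mU; have := hy t mU.
by rewrite mulmx0 (_ : (0 : 'M[R]_1) 0 0 = 0)// mxE.
Qed.

Let moments_L t : moments (L t).
Proof.
have [_ S0] := hS.
split => // k; exact: (normal_law_integrable_expr (measurable_L t) (S0 t) (@L_law t)).
Qed.

Let mean_LX t k : mean (fun w => L t w ^+ k.+1) = q t t * k%:R * mean (fun w => L t w ^+ k.-1).
Proof.
have [_ S0] := hS; apply/eqP; rewrite eq_sym -subr_eq0 -meanZ; last exact: momentsX.
rewrite -meanB; [|by apply: momentsZ; exact: momentsX|exact: momentsX].
rewrite -(inj_eq (@EFin_inj _)) -expectation_mean; last first.
  by apply: momentsD; [apply: momentsZ|apply: momentsN]; exact: momentsX.
by rewrite unlock (normal_law_stein (measurable_L t) (S0 t) (@L_law t)).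
Qed.

(* Replace t by t + x s in mean_LX and compare the coefficients of x. *)
Let mean_LM s t m :
  mean (fun w => L s w * L t w ^+ m) = m%:R * q s t * mean (fun w => L t w ^+ m.-1).
Proof.
have e1 k : mean (fun w => 1 * L t w ^+ k) = mean (fun w => L t w ^+ k).
  by congr (mean _); apply/funext => w; rewrite mul1r.
have e2 k : mean (fun w => 1 * L t w ^+ k * L s w) = mean (fun w => L s w * L t w ^+ k).
  by congr (mean _); apply/funext => w; rewrite mul1r mulrC.
have e3 g : mean (fun w => 1 * g w) = mean g.
  by congr (mean _); apply/funext => w; rewrite mul1r.
(* The coefficient of x brings back the same mixed moment with exponent lowered by two, hence the
   strong induction with two base cases. *)
have main k : k.+1%:R * mean (fun w => L s w * L t w ^+ k) = k%:R *
    (q t t * (k.-1%:R * mean (fun w => L s w * L t w ^+ k.-2)) +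
     2 * q s t * mean (fun w => L t w ^+ k.-1)).
  have : mean_poly P (fun=> 1) (L t) (L s) k.+1 =
     k%:R *: (((q t t)%:P + (2 * q s t) *: 'X + (q s s) *: 'X^2) *
        mean_poly P (fun=> 1) (L t) (L s) k.-1).
    apply: eq_horner_poly => x.
    have c1 : moments (fun=> 1) by exact: moments_cst.
    rewrite hornerZ hornerM !hornerD !hornerZ hornerC hornerX hornerXn.
    rewrite !horner_mean_poly//.
    rewrite !e3; under eq_fun do rewrite -LD.
    under [X in _ = _ * (_ * mean X)]eq_fun do rewrite -LD.
    by rewrite mean_LX qDl !qDr (qC t s) mulrA; congr (_ * _); ring.
  move/(congr1 (fun r : {poly R} => r`_1)).
  rewrite mean_poly1 e2 coefZ => ->; congr (_ * _).
  rewrite coefM !big_ord_recl big_ord0 /= /bump /= !coefD !coefZ !coefC !coefX !coefXn /=.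
  by rewrite mean_poly0 mean_poly1 e1 e2; ring.
elim/ltn_ind: m => -[|[|m]] IH.
- by have := main 0%N; rewrite !mul0r mul1r.
- have := main 1%N; rewrite /= !mul0r mulr0 add0r !mul1r => h.
  by apply: (@mulfI _ 2); rewrite ?pnatr_eq0// h mulrA.
(* By [mean_LX], q(t,t) m E[L_t^(m-1)] is E[L_t^(m+1)], so the bracket becomes (m+1) + 2 = m+3 times
   q(s,t) E[L_t^(m+1)], and m+3 cancels. *)
- have := main m.+2; rewrite /= (IH m (leqW (ltnSn m))).
  rewrite mean_LX => h; apply: (@mulfI _ m.+3%:R); first by rewrite pnatr_eq0.
  by rewrite h; ring.
Qed.

Let Lprod (ls : seq 'cV[R]_p) w : R := \prod_(l <- ls) L l w.
(** The sum over all ways of contracting [L s] with one factor of the product, as in Wick's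
    formula. *)
Let dLprod (s : 'cV[R]_p) := fix dLprod (ls : seq 'cV[R]_p) (w : T) : R :=
  if ls is l :: ls' then q s l * Lprod ls' w + L l w * dLprod ls' w else 0.

Let moments_Lprod ls : moments (Lprod ls).
Proof. by apply: moments_prod => l _; exact: moments_L. Qed.

Let moments_dLprod s ls : moments (dLprod s ls).
Proof.
elim: ls => [|l ls IH] /=; first exact: moments_cst.
by apply: momentsD; [exact: momentsZ|exact: momentsM].
Qed.

(* The factors of the product are split off one at a time from the power of t,
   again by comparing the coefficients of x after replacing t by t + x u. *)
Let mean_LLprod s ls t m :
  mean (fun w => L s w * Lprod ls w * L t w ^+ m) =
  mean (fun w => dLprod s ls w * L t w ^+ m) +
  m%:R * q s t * mean (fun w => Lprod ls w * L t w ^+ m.-1).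
Proof.
elim: ls t m => [|u ls IH] t m.
  rewrite (_ : mean (fun w => dLprod _ _ _ * _) = 0) ?add0r; last first.
    by rewrite -(mean_cst P 0); congr (mean _); apply/funext => w; rewrite mul0r.
  under [in RHS]eq_fun do rewrite /Lprod big_nil mul1r.
  by rewrite -mean_LM; under eq_fun do rewrite /Lprod big_nil mulr1.
have : mean_poly P (fun w => L s w * Lprod ls w) (L t) (L u) m.+1 =
    mean_poly P (dLprod s ls) (L t) (L u) m.+1 +
    m.+1%:R *: (((q s t)%:P + (q s u) *: 'X) * mean_poly P (Lprod ls) (L t) (L u) m).
  apply: eq_horner_poly => x.
  rewrite hornerD hornerZ hornerM !hornerD !hornerZ hornerC hornerX.
  have h1 : moments (fun w => L s w * Lprod ls w) by exact: momentsM.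
  rewrite !horner_mean_poly//.
  (* The exponent is [m.+1] because taking the coefficient of x turns one factor [L t] into [L u],
     leaving the wanted power [m]. *)
  have := IH (t + x *: u) m.+1; rewrite qDr.
  under eq_fun do rewrite LD.
  under [X in _ = mean X + _]eq_fun do rewrite LD.
  under [X in _ = _ + _ * mean X]eq_fun do rewrite LD.
  by move=> ->; congr (_ + _); rewrite -!mulrA (mulrC x).
move/(congr1 (fun r : {poly R} => r`_1)).
rewrite coefD !mean_poly1 coefZ -mulrDr => /mulfI; rewrite pnatr_eq0 => /(_ isT).
rewrite coefM !big_ord_recl big_ord0 /= /bump /= !coefD !coefZ !coefC !coefX /=.
rewrite mean_poly0 mean_poly1 => h.
transitivity (mean (fun w => L s w * Lprod ls w * L t w ^+ m * L u w)).
  by congr (mean _); apply/funext => w; rewrite /Lprod big_cons; ring.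
rewrite {}h.
rewrite (_ : mean (fun w => Lprod (u :: ls) w * _) =
  mean (fun w => Lprod ls w * L t w ^+ m.-1 * L u w)); last first.
  by congr (mean _); apply/funext => w; rewrite /Lprod big_cons; ring.
rewrite (_ : mean (fun w => (q s u * Lprod ls w + L u w * dLprod s ls w) * L t w ^+ m) =
  q s u * mean (fun w => Lprod ls w * L t w ^+ m) +
  mean (fun w => dLprod s ls w * L t w ^+ m * L u w)).
  by ring.
rewrite -meanZ; last by apply: momentsM => //; exact: momentsX.
rewrite -meanD; last 2 first.
  by apply: momentsZ; apply: momentsM => //; exact: momentsX.
  by apply: momentsM => //; apply: momentsM => //; exact: momentsX.
by congr (mean _); apply/funext => w; ring.
Qed.

Lemma moments_mvnormal_entry a : moments (fun w => y w a 0).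
Proof.
have := moments_L (delta_mx a 0); congr moments; apply/funext => w.
by rewrite /L trmx_delta -rowE mxE.
Qed.

Definition mono (bs : seq 'I_p) (v : 'cV[R]_p) : R := \prod_(b <- bs) v b 0.

(* Derivative of mono bs in the direction of the a-th row of Sigma. *)
Fixpoint dmono (a : 'I_p) (bs : seq 'I_p) (v : 'cV[R]_p) : R :=
  if bs is b :: bs' then Sigma a b * mono bs' v + v b 0 * dmono a bs' v else 0.

Lemma mvnormal_stein a bs :
  mean (fun w => y w a 0 * mono bs (y w)) = mean (fun w => dmono a bs (y w)).
Proof.
have LE b w : L (delta_mx b 0) w = y w b 0 by rewrite /L trmx_delta -rowE mxE.
have qE b c : q (delta_mx b 0) (delta_mx c 0) = Sigma b c.
  by rewrite /q trmx_delta -rowE -colE !mxE.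
pose D b : 'cV[R]_p := delta_mx b 0.
(* The power of an auxiliary linear form served only the induction; exponent 0 removes it. *)
have := mean_LLprod (D a) [seq D b | b <- bs] 0 0.
rewrite !mul0r addr0.
under eq_fun do rewrite mulr1 LE /Lprod big_map.
under [in X in _ = X -> _]eq_fun do rewrite mulr1.
have -> : (fun w => y w a 0 * mono bs (y w)) =
    (fun w => y w a 0 * \prod_(b <- bs) L (D b) w).
  by apply/funext => w; congr (_ * _); apply: eq_bigr => b _; rewrite LE.
move=> ->; congr (mean _); apply/funext => w.
elim: bs => //= b bs ->; rewrite LE qE /Lprod big_map; congr (_ * _ + _).
by apply: eq_bigr => c _; rewrite LE.
Qed.

End mvnormal.

(** * Expectation of products of independent variables *)

Import HBNNSimple.

Section independence.
Context {R : realType} d d' (T : measurableType d) (T' : measurableType d')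
  (P : probability T R).
Local Notation mean := (Rmean P).
Local Notation moments := (moments P).

Lemma moments_dominated (f g : T -> R) : measurable_fun setT f -> moments g ->
  (forall w, `|f w| <= `|g w|) -> moments f.
Proof.
move=> mf [mg ig] fg; split=> // k; apply: (le_integrable _ _ _ (ig k)) => //.
  by apply/measurable_EFinP; exact: measurable_funX.
by move=> w _; rewrite !abse_EFin lee_fin !normrX lerXn2r ?nnegrE.
Qed.

Lemma moments_indic (A : set T) : measurable A -> moments \1_A.
Proof.
move=> mA; apply: (@moments_bounded _ _ _ _ _ 1); first exact: measurable_indic.
by move=> w; rewrite indicE; case: (_ \in _); rewrite ?normr1 ?normr0.
Qed.

Lemma mean_indic (A : set T) : measurable A -> mean \1_A = fine (P A).
Proof.
by move=> mA; rewrite /Rmean /Rintegral integral_indic// setIT.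
Qed.

Variables (X : T -> T') (mX : measurable_fun setT X) (g : T -> R) (c : R).
Hypothesis hg : moments g.
Hypothesis hgc : forall U, measurable U ->
  mean (fun w => g w * \1_U (X w)) = c * mean (fun w => \1_U (X w)).

Let moments_indicX U : measurable U -> moments (fun w => \1_U (X w)).
Proof.
move=> mU; rewrite (_ : (fun w => _) = \1_(X @^-1` U)); last exact/funext.
by apply: moments_indic; rewrite -[X @^-1` U]setTI; exact: mX.
Qed.

Let mean_nnsfun (h : {nnsfun T' >-> R}) :
  mean (fun w => g w * h (X w)) = c * mean (fun w => h (X w)).
Proof.
have hE x : h x = \sum_(r <- finmap.enum_fset (fset_set (range h))) r * \1_(h @^-1` [set r]) x.
  by rewrite [LHS]fimfunE fsbig_finite//.
have mU r : measurable (h @^-1` [set r]) by exact: measurable_sfunP.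
transitivity (mean (fun w =>
    \sum_(r <- finmap.enum_fset (fset_set (range h))) r * (g w * \1_(h @^-1` [set r]) (X w)))).
  congr (mean _); apply/funext => w; rewrite hE big_distrr/=.
  by apply: eq_bigr => r _; rewrite mulrCA.
under [in RHS]eq_fun do rewrite hE.
rewrite !mean_sum; first last.
- by move=> r _; apply: momentsZ; apply: momentsM => //; exact: moments_indicX.
- by move=> r _; apply: momentsZ; exact: moments_indicX.
rewrite big_distrr/=; apply: eq_bigr => r _.
rewrite !meanZ ?hgc//; [ring|exact: moments_indicX|].
by apply: momentsM => //; exact: moments_indicX.
Qed.

(** The factor [k] will be [g] on one side of the identity and the constant [c] on the other; both
    limits are dominated by the limit function, the approximations lying below [f]. *)
Let cvg_mean_approx (k : T -> R) (f : T' -> R) (mf : measurable_fun setT (EFin \o f)) :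
  (forall x, 0 <= f x) -> moments k -> moments (fun w => f (X w)) ->
  mean (fun w => k w * nnsfun_approx measurableT mf n (X w)) @[n --> \oo] -->
  mean (fun w => k w * f (X w)).
Proof.
move=> f0 hk hf.
have mapp n : measurable_fun setT (fun w => k w * nnsfun_approx measurableT mf n (X w)).
  apply: measurable_funM; first exact: moments_measurable hk.
  by apply: (measurableT_comp _ mX); exact: measurable_funPT.
have fE0 x : setT x -> (0 <= (EFin \o f) x)%E by rewrite lee_fin.
have ile : P.-integrable setT (fun w => (k w * f (X w))%:E).
  by apply: moments_integrable; exact: momentsM.
have cvgI : (\int[P]_w (k w * nnsfun_approx measurableT mf n (X w))%:E)%E @[n --> \oo]
    --> (\int[P]_w (k w * f (X w))%:E)%E.
  apply: (@dominated_cvg _ _ _ P setT measurableT _ _ (fun w => `|(k w * f (X w))%:E|%E)) => //.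
  - by move=> n; apply/measurable_EFinP.
  - move=> w _; apply: cvg_EFin; first exact: nearW.
    have /fine_cvgP[_ h] : (EFin \o nnsfun_approx measurableT mf ^~ (X w)) @ \oo --> (f (X w))%:E.
      exact: (cvg_nnsfun_approx measurableT mf fE0).
    by apply: cvgMr; exact: h.
  - exact: integrable_abse.
  - move=> n w _; rewrite !abse_EFin lee_fin !normrM ler_wpM2l//.
    rewrite !ger0_norm// -lee_fin nnsfun_approxE.
    by apply: le_approx => // x _; rewrite /= lee_fin.
move: cvgI; rewrite (_ : (\int[P]_w (k w * f (X w))%:E)%E =
    (mean (fun w => k w * f (X w)))%:E); last first.
  by rewrite /Rmean /Rintegral fineK//; exact: integrable_fin_num.
by move/fine_cvgP => [_ h]; exact: h.
Qed.

Let mean_factor_ge0 (f : T' -> R) : measurable_fun setT f -> (forall x, 0 <= f x) ->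
  moments (fun w => f (X w)) ->
  mean (fun w => g w * f (X w)) = c * mean (fun w => f (X w)).
Proof.
move=> mf f0 hf.
have mEf : measurable_fun setT (EFin \o f) by exact/measurable_EFinP.
have h1 := cvg_mean_approx mEf f0 hg hf.
have h2 := cvg_mean_approx mEf f0 (moments_cst P c) hf.
have e n : mean (fun w => c * nnsfun_approx measurableT mEf n (X w)) =
    mean (fun w => g w * nnsfun_approx measurableT mEf n (X w)).
  rewrite mean_nnsfun meanZ//; apply: (moments_dominated _ hf).
    by apply: (measurableT_comp _ mX); exact: measurable_funPT.
  move=> w; rewrite !ger0_norm// -lee_fin nnsfun_approxE.
  by apply: le_approx => // x _; rewrite /= lee_fin.
move: h2; rewrite (eq_cvg _ _ e) => h2.
by rewrite -meanZ//; exact: (cvg_unique _ h1 h2).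
Qed.

(** The hypothesis on indicators extends to simple functions by linearity, to nonnegative functions
    by dominated convergence, and to all by positive and negative parts. The constant [c] is
    necessarily the mean of [g], but enters only through that hypothesis. *)
Lemma mean_factor (f : T' -> R) : measurable_fun setT f ->
  moments (fun w => f (X w)) ->
  mean (fun w => g w * f (X w)) = c * mean (fun w => f (X w)).
Proof.
move=> mf hf.
pose fp x := Num.max (f x) 0; pose fn x := Num.max (- f x) 0.
have fE x : f x = fp x - fn x.
  rewrite /fp /fn; have [f0|f0] := leP 0 (f x).
    by rewrite (max_idPr _) ?subr0// oppr_le0.
  by rewrite (max_idPl _) ?oppr_ge0 ?ltW// sub0r opprK.
have fp0 x : 0 <= fp x by rewrite le_max lexx orbT.
have fn0 x : 0 <= fn x by rewrite le_max lexx orbT.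
have mfp : measurable_fun setT fp by exact: measurable_maxr.
have mfn : measurable_fun setT fn.
  by apply: measurable_maxr => //; exact: measurable_funN.
have hfp : moments (fun w => fp (X w)).
  apply: (moments_dominated _ hf); first exact: measurableT_comp.
  by move=> w; rewrite ger0_norm// ge_max ler_norm normr_ge0.
have hfn : moments (fun w => fn (X w)).
  apply: (moments_dominated _ hf); first exact: measurableT_comp.
  by move=> w; rewrite ger0_norm// ge_max -normrN ler_norm normr_ge0.
under [in RHS]eq_fun do rewrite fE.
under eq_fun do rewrite fE mulrBr.
rewrite !meanB ?mean_factor_ge0 ?mulrBr//; exact: momentsM.
Qed.

End independence.

Section independent_mean.
Context {R : realType} d d' (T : measurableType d) (T' : measurableType d')
  (P : probability T R) (I : finType) (X : I -> {RV P >-> T'}).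
Hypothesis indep : independent_RVs X.
Local Notation mean := (Rmean P).
Local Notation moments := (moments P).

Lemma independent_mean (f : I -> T' -> R) : (forall i, measurable_fun setT (f i)) ->
  (forall i, moments (fun w => f i (X i w))) ->
  mean (fun w => \prod_i f i (X i w)) = \prod_i mean (fun w => f i (X i w)).
Proof.
(* Strengthened for induction on [s]: the functions with index outside [s] are indicators. The empty
   list is the definition of independence, and the full list is the claim. *)
suff h (s : seq I) (h : I -> T' -> R) :
    (forall i, i \notin s -> exists2 U, measurable U & h i = \1_U) ->
    (forall i, measurable_fun setT (h i)) ->
    (forall i, moments (fun w => h i (X i w))) ->
  mean (fun w => \prod_i h i (X i w)) = \prod_i mean (fun w => h i (X i w)).
  by apply: (h (enum I)) => i; rewrite mem_enum.
elim: s h => [|i0 s IH] h hU mh hh.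
  have /choice[U hU'] : forall i, exists U, measurable U /\ h i = \1_U.
    by move=> i; have [U mU hE] := hU i isT; exists U.
  have mU i : measurable (U i) by case: (hU' i).
  have mXU i : measurable (X i @^-1` U i).
    by rewrite -[X in measurable X]setTI; exact: measurable_funPT.
  have hE i w : h i (X i w) = \1_(X i @^-1` U i) w by case: (hU' i) => _ ->.
  under eq_fun do under eq_bigr do rewrite hE.
  under [RHS]eq_bigr do under eq_fun do rewrite hE.
  have := @indep [set i : I | true]%SET U mU.
  rewrite (_ : (\bigcap_(i in _) _) = \bigcap_i (X i @^-1` U i)); last first.
    by apply/seteqP; split=> w hw i _; apply: hw; rewrite //= inE.
  have mcap : measurable (\bigcap_i (X i @^-1` U i)).
    by apply: fin_bigcap_measurable => //; exact: finite_finset.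
  rewrite (_ : (fun w => _) = \1_(\bigcap_i (X i @^-1` U i))); last first.
    apply/funext => w; rewrite indicE.
    have [wU|wU] := boolP (w \in _).
      rewrite big1// => i _; rewrite indicE mem_set//.
      by move: wU; rewrite inE => wU; exact: wU.
    move: wU; rewrite notin_setE => /existsNP[i] /not_implyP[_ wi].
    by rewrite (bigD1 i)//= indicE memNset// mul0r.
  rewrite mean_indic// => ->.
  rewrite [X in fine X](eq_bigl predT); last first.
    by move=> i; first [apply/idP; rewrite //= inE | rewrite finset.inE | rewrite finset.in_set].
  rewrite (eq_bigr (fun i => (mean \1_(X i @^-1` U i))%:E)); last first.
    by move=> i _; rewrite mean_indic// fineK// fin_num_measure.
  by rewrite prodEFin.
pose g (w : T) := \prod_(i | i != i0) h i (X i w).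
pose c := \prod_(i | i != i0) mean (fun w => h i (X i w)).
have hg : moments g by apply: moments_prod.
have -> : (fun w => \prod_i h i (X i w)) = (fun w => g w * h i0 (X i0 w)).
  by apply/funext => w; rewrite (bigD1 i0)//= mulrC.
(* By [mean_factor] it is enough to treat the case where [h i0] is an indicator, to which the
   shorter list applies. *)
rewrite (bigD1 i0)//= mulrC -/c; apply: mean_factor => // U mU.
pose h' i := if i == i0 then \1_U else h i : T' -> R.
have h'0 : h' i0 = \1_U by rewrite /h' eqxx.
have h'N i : i != i0 -> h' i = h i by rewrite /h' => /negPf ->.
have IHh' : mean (fun w => \prod_i h' i (X i w)) = \prod_i mean (fun w => h' i (X i w)).
  apply: IH => i.
  - move=> iNs; have [->|ii0] := eqVneq i i0; first by exists U.
    by rewrite h'N//; apply: hU; rewrite in_cons negb_or ii0.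
  - have [->|ii0] := eqVneq i i0; last by rewrite h'N.
    by rewrite h'0; exact: measurable_indic.
  - have [->|ii0] := eqVneq i i0; last by rewrite h'N.
    rewrite h'0 (_ : (fun w => _) = \1_(X i0 @^-1` U)); last exact/funext.
    by apply: moments_indic; rewrite -[X in measurable X]setTI; exact: measurable_funPT.
transitivity (mean (fun w => \prod_i h' i (X i w))).
  congr (mean _); apply/funext => w; rewrite [RHS](bigD1 i0)//= h'0 mulrC.
  by congr (_ * _); apply: eq_bigr => i ii0; rewrite h'N.
rewrite IHh' (bigD1 i0)//= h'0 mulrC; congr (_ * _).
by apply: eq_bigr => i ii0; rewrite h'N.
Qed.

End independent_mean.

(** * Integration by parts for polynomials in independent Gaussian vectors *)

Section joint_stein.
Context {R : realType} d (T : measurableType d) (P : probability T R).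
Context (p n : nat) (Sigma : 'M[R]_p) (y : 'I_n -> {RV P >-> 'cV[R]_p}).
Hypothesis hS : is_covariance_mx Sigma.
Hypothesis indep : independent_RVs y.
Hypothesis hy : forall j, is_mvnormal 0 Sigma (y j).
Local Notation mean := (Rmean P).
Local Notation moments := (moments P).
Local Notation dmono := (dmono Sigma).

Definition jmono (s : seq ('I_p * 'I_n)) (w : T) : R := \prod_(x <- s) y x.2 w x.1 0.

(** The analogue of [dmono] for several vectors: only the factors coming from [y j] are
    differentiated. *)
Fixpoint djmono (a : 'I_p) (j : 'I_n) (s : seq ('I_p * 'I_n)) (w : T) : R :=
  if s is x :: s' then
    (x.2 == j)%:R * Sigma a x.1 * jmono s' w + y x.2 w x.1 0 * djmono a j s' w
  else 0.

Let part (k : 'I_n) (s : seq ('I_p * 'I_n)) := [seq x.1 | x <- s & x.2 == k].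

Let jmonoE s w : jmono s w = \prod_k mono (part k s) (y k w).
Proof.
elim: s => [|x s IH]; first by rewrite /jmono big_nil big1// => k _; rewrite /mono big_nil.
rewrite /jmono big_cons -/(jmono s w) IH.
rewrite (bigD1 x.2)//= [RHS](bigD1 x.2)//= mulrA; congr (_ * _).
  by rewrite /part /= eqxx /= /mono big_cons.
by apply: eq_bigr => k kx; rewrite /part /= eq_sym (negPf kx).
Qed.

Let djmonoE a j s w : djmono a j s w =
  dmono a (part j s) (y j w) * \prod_(k | k != j) mono (part k s) (y k w).
Proof.
elim: s => [|x s IH]; first by rewrite /= mul0r.
rewrite /= IH jmonoE (bigD1 j)//=.
have [xj|xj] := eqVneq x.2 j.
  have -> : part j (x :: s) = x.1 :: part j s by rewrite /part /= xj eqxx.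
  have -> : \prod_(k | k != j) mono (part k (x :: s)) (y k w) =
      \prod_(k | k != j) mono (part k s) (y k w).
    by apply: eq_bigr => k kj; rewrite /part /= xj eq_sym (negPf kj).
  by rewrite /= xj; ring.
have -> : part j (x :: s) = part j s by rewrite /part /= (negPf xj).
have -> : \prod_(k | k != j) mono (part k (x :: s)) (y k w) =
    y x.2 w x.1 0 * \prod_(k | k != j) mono (part k s) (y k w).
  rewrite (bigD1 x.2)//= [in RHS](bigD1 x.2)//= mulrA; congr (_ * _).
    by rewrite /part /= eqxx /= /mono big_cons.
  by apply: eq_bigr => k /andP[_ kx]; rewrite /part /= eq_sym (negPf kx).
by rewrite !mul0r add0r mulrCA.
Qed.

Let mentry a : measurable_fun setT (fun v : 'cV[R]_p => v a 0).
Proof. exact: measurable_mx_entry. Qed.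

Let mmono bs : measurable_fun setT (mono bs : 'cV[R]_p -> R).
Proof. exact: measurable_prod. Qed.

Let mdmono a bs : measurable_fun setT (dmono a bs).
Proof.
elim: bs => [|b bs IH] /=; first exact: measurable_cst.
by apply: measurable_funD; apply: measurable_funM.
Qed.

Lemma moments_entry a j : moments (fun w => y j w a 0).
Proof. exact: (moments_mvnormal_entry hS (hy j)). Qed.

Let momono j bs : moments (fun w => mono bs (y j w)).
Proof. by apply: moments_prod => b _; exact: moments_entry. Qed.

Let modmono a j bs : moments (fun w => dmono a bs (y j w)).
Proof.
elim: bs => [|b bs IH] /=; first exact: moments_cst.
by apply: momentsD; [apply: momentsZ|apply: momentsM => //; exact: moments_entry].
Qed.

Lemma moments_jmono s : moments (jmono s).
Proof. by apply: moments_prod => x _; exact: moments_entry. Qed.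

Lemma moments_djmono a j s : moments (djmono a j s).
Proof.
elim: s => [|x s IH] /=; first exact: moments_cst.
apply: momentsD; first by apply: momentsZ; exact: moments_jmono.
by apply: momentsM => //; exact: moments_entry.
Qed.

Let mean_indep j (f : 'cV[R]_p -> R) s : measurable_fun setT f ->
  moments (fun w => f (y j w)) ->
  mean (fun w => f (y j w) * \prod_(k | k != j) mono (part k s) (y k w)) =
  mean (fun w => f (y j w)) *
  \prod_(k | k != j) mean (fun w => mono (part k s) (y k w)).
Proof.
move=> mf hf.
pose h k : 'cV[R]_p -> R := if k == j then f else mono (part k s).
have h0 : h j = f by rewrite /h eqxx.
have hN k : k != j -> h k = mono (part k s) by rewrite /h => /negPf ->.
have E : mean (fun w => \prod_k h k (y k w)) = \prod_k mean (fun w => h k (y k w)).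
  apply: (independent_mean indep) => k.
    by have [->|kj] := eqVneq k j; rewrite ?h0 ?hN.
  by have [->|kj] := eqVneq k j; rewrite ?h0 ?hN.
transitivity (mean (fun w => \prod_k h k (y k w))).
  congr (mean _); apply/funext => w; rewrite [RHS](bigD1 j)//= h0.
  by congr (_ * _); apply: eq_bigr => k kj; rewrite hN.
rewrite E (bigD1 j)//= h0; congr (_ * _).
by apply: eq_bigr => k kj; rewrite hN.
Qed.

(** Grouping the monomial by vectors, the factors from the other [y k] are independent of [y j];
    they split off, the identity for one vector applies to the rest, and they are multiplied back
    in. *)
Lemma mean_jmono_stein a j s :
  mean (fun w => y j w a 0 * jmono s w) = mean (djmono a j s).
Proof.
transitivity (mean (fun w => (y j w a 0 * mono (part j s) (y j w)) *
    \prod_(k | k != j) mono (part k s) (y k w))).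
  by congr (mean _); apply/funext => w; rewrite jmonoE (bigD1 j)//= mulrA.
rewrite (mean_indep (f := fun v => v a 0 * mono (part j s) v)).
- rewrite (mvnormal_stein hS (hy j)) -mean_indep//.
  by congr (mean _); apply/funext => w; rewrite djmonoE.
- exact: measurable_funM.
- by apply: momentsM => //; exact: moments_entry.
Qed.

(* F is a polynomial in the entries of the y j, and G a j its derivative in the
   direction of the a-th row of Sigma in y j.  As Sigma may be singular, F as a
   function on T does not determine the polynomial, so that the derivative has
   to be carried along. *)
Definition poly_pair (F : T -> R) (G : 'I_p -> 'I_n -> T -> R) : Prop :=
  exists l : seq (R * seq ('I_p * 'I_n)),
    (forall w, F w = \sum_(x <- l) x.1 * jmono x.2 w) /\
    (forall a j w, G a j w = \sum_(x <- l) x.1 * djmono a j x.2 w).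

Lemma poly_pair_moments F G : poly_pair F G -> moments F.
Proof.
move=> [l [/funext -> _]]; apply: moments_sum => x _.
by apply: momentsZ; exact: moments_jmono.
Qed.

Lemma poly_pair_momentsd F G a j : poly_pair F G -> moments (G a j).
Proof.
move=> [l [_ hG]]; rewrite (funext (hG a j)); apply: moments_sum => x _.
by apply: momentsZ; exact: moments_djmono.
Qed.

Lemma poly_pair_stein F G a j : poly_pair F G ->
  mean (fun w => y j w a 0 * F w) = mean (G a j).
Proof.
move=> [l [/funext -> hG]]; rewrite (funext (hG a j)).
under eq_fun do rewrite big_distrr/=.
rewrite !mean_sum; first last.
- move=> x _; apply: momentsM; first exact: moments_entry.
  by apply: momentsZ; exact: moments_jmono.
- by move=> x _; apply: momentsZ; exact: moments_djmono.
apply: eq_bigr => x _; rewrite meanZ; last exact: moments_djmono.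
rewrite -mean_jmono_stein -meanZ; last first.
  by apply: momentsM; [exact: moments_entry|exact: moments_jmono].
by congr (mean _); apply/funext => w; rewrite mulrCA.
Qed.

Lemma poly_pair_ext F G F' G' : (forall w, F w = F' w) ->
  (forall a j w, G a j w = G' a j w) -> poly_pair F G -> poly_pair F' G'.
Proof.
move=> hF hG [l [h1 h2]]; exists l; split=> [w|a j w]; by rewrite -?hF -?hG.
Qed.

Lemma poly_pair_cst c : poly_pair (fun=> c) (fun _ _ _ => 0).
Proof.
exists [:: (c, [::])]; split=> *; rewrite big_seq1 ?mulr0//.
by rewrite /jmono big_nil mulr1.
Qed.

Lemma poly_pair_entry b k :
  poly_pair (fun w => y k w b 0) (fun a j _ => (k == j)%:R * Sigma a b).
Proof.
exists [:: (1, [:: (b, k)])]; split=> *; rewrite big_seq1 mul1r /=.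
  by rewrite /jmono big_seq1.
by rewrite /jmono big_nil mulr1 mulr0 addr0.
Qed.

Lemma poly_pairD F G F' G' : poly_pair F G -> poly_pair F' G' ->
  poly_pair (fun w => F w + F' w) (fun a j w => G a j w + G' a j w).
Proof.
move=> [l [h1 h2]] [l' [h1' h2']]; exists (l ++ l').
by split=> *; rewrite big_cat /= ?h1 ?h1' ?h2 ?h2'.
Qed.

Lemma poly_pair_sum (I : Type) (r : seq I) F G :
  (forall i, poly_pair (F i) (G i)) ->
  poly_pair (fun w => \sum_(i <- r) F i w) (fun a j w => \sum_(i <- r) G i a j w).
Proof.
move=> h; elim: r => [|i r IH].
  by apply: (poly_pair_ext _ _ (poly_pair_cst 0)) => *; rewrite big_nil.
by apply: (poly_pair_ext _ _ (poly_pairD (h i) IH)) => *; rewrite big_cons.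
Qed.

Lemma jmono_cat s s' w : jmono (s ++ s') w = jmono s w * jmono s' w.
Proof. by rewrite /jmono big_cat. Qed.

Lemma djmono_cat a j s s' w :
  djmono a j (s ++ s') w = djmono a j s w * jmono s' w + jmono s w * djmono a j s' w.
Proof.
elim: s => [|x s IH] /=; first by rewrite /jmono big_nil mul0r add0r mul1r.
have -> : jmono (x :: s) w = y x.2 w x.1 0 * jmono s w by rewrite /jmono big_cons.
by rewrite IH jmono_cat; ring.
Qed.

(** The Leibniz rule. With the closure under sums it lets the derivative be computed along the
    structure of an expression, without ever expanding it into monomials. *)
Lemma poly_pairM F G F' G' : poly_pair F G -> poly_pair F' G' ->
  poly_pair (fun w => F w * F' w) (fun a j w => G a j w * F' w + F w * G' a j w).
Proof.
move=> [l [h1 h2]] [l' [h1' h2']].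
exists [seq (x.1 * x'.1, x.2 ++ x'.2) | x <- l, x' <- l'].
split=> [w|a j w]; rewrite big_allpairs_dep /= ?h1 ?h1' ?h2 ?h2'.
  rewrite big_distrl/=; apply: eq_bigr => x _; rewrite big_distrr/=.
  by apply: eq_bigr => x' _; rewrite jmono_cat; ring.
rewrite !big_distrl/= -big_split/=; apply: eq_bigr => x _.
rewrite !big_distrr/= -big_split/=; apply: eq_bigr => x' _.
by rewrite djmono_cat; ring.
Qed.

Definition mx_pair r c (M : T -> 'M[R]_(r, c)) (D : 'I_p -> 'I_n -> T -> 'M[R]_(r, c)) :=
  forall i k, poly_pair (fun w => M w i k) (fun a j w => D a j w i k).

Definition ymx (w : T) : 'M[R]_(p, n) := \matrix_(i, k) y k w i 0.

Lemma mx_pair_cst r c (M : 'M[R]_(r, c)) : mx_pair (fun=> M) (fun _ _ _ => 0).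
Proof.
by move=> i k; apply: (poly_pair_ext _ _ (poly_pair_cst (M i k))) => *; rewrite ?mxE.
Qed.

(** Moving column j of Y along row a of [Sigma], which by symmetry is also its column a, changes Y
    by [Sigma *m delta_mx a j]. *)
Lemma mx_pair_ymx : mx_pair ymx (fun a j _ => Sigma *m delta_mx a j).
Proof.
move=> b k; apply: (poly_pair_ext _ _ (poly_pair_entry b k)) => [w|a j w].
  by rewrite mxE.
have [St _] := hS; rewrite mxE (bigD1 a)//= big1 ?addr0; last first.
  by move=> i /negPf ia; rewrite mxE ia mulr0.
by rewrite !mxE eqxx /= mulrC -[in LHS]St mxE.
Qed.

Lemma mx_pair_tr r c (M : T -> 'M[R]_(r, c)) D : mx_pair M D ->
  mx_pair (fun w => (M w)^T) (fun a j w => (D a j w)^T).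
Proof. by move=> h i k; apply: (poly_pair_ext _ _ (h k i)) => *; rewrite mxE. Qed.

Lemma mx_pairM r c e (M : T -> 'M[R]_(r, c)) (M' : T -> 'M[R]_(c, e)) D D' :
  mx_pair M D -> mx_pair M' D' ->
  mx_pair (fun w => M w *m M' w) (fun a j w => D a j w *m M' w + M w *m D' a j w).
Proof.
move=> h h' i k.
apply: (poly_pair_ext _ _ (poly_pair_sum (index_enum _)
  (fun l => poly_pairM (h i l) (h' l k)))) => *; rewrite ?mxE//.
by rewrite big_split.
Qed.

Lemma mx_pair_trace r (M : T -> 'M[R]_r) D : mx_pair M D ->
  poly_pair (fun w => \tr (M w)) (fun a j w => \tr (D a j w)).
Proof.
by move=> h; exact: (poly_pair_sum (index_enum _) (fun l => h l l)).
Qed.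

End joint_stein.

(** * Derivatives of words in the Gram matrix *)

(* Words are lists over the letters 0 = Sigma, 1 = A, 2 = B and 3 = W (any larger
   number also stands for W); a list of words stands for the product of their
   traces. *)
Definition is_W (c : nat) : bool := (2 < c)%N.

(** One pair per W in [u], with the words before and after it. The accumulator [pre] keeps the left
    part, as the inductions over [u] require. *)
Fixpoint splits (pre u : seq nat) : seq (seq nat * seq nat) :=
  if u is c :: u' then
    let r := splits (rcons pre c) u' in if is_W c then (pre, u') :: r else r
  else [::].

(* The terms of the recursion for tr(W u) ws in which the first factor Y of W is
   contracted with a W of u, respectively of ws. *)
Definition wterms (u : seq nat) (ws : seq (seq nat)) : seq (seq (seq nat)) :=
  flatten [seq [:: (3 :: x.1 ++ 0 :: rev x.2) :: ws; (3 :: x.1) :: (0 :: x.2) :: ws]%N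
          | x <- splits [::] u].

(** [acc] holds the traces already passed, which multiply every later term. *)
Fixpoint hterms (u : seq nat) (acc ws : seq (seq nat)) : seq (seq (seq nat)) :=
  if ws is v :: ws' then
    flatten [seq [:: (3 :: u ++ 0 :: rev x.1 ++ rev x.2) :: acc ++ ws';
                     (3 :: u ++ 0 :: x.2 ++ x.1) :: acc ++ ws']%N
            | x <- splits [::] v] ++ hterms u (v :: acc) ws'
  else [::].

Section words.
Context {R : comNzRingType} (p n : nat) (Sigma A B : 'M[R]_p).
Hypotheses (SigmaT : Sigma^T = Sigma) (AT : A^T = A) (BT : B^T = B).

Definition letter (V : 'M[R]_p) (c : nat) : 'M[R]_p :=
  match c with 0 => Sigma | 1 => A | 2 => B | _ => V end.

Definition word V (u : seq nat) : 'M[R]_p := foldr (fun c M => letter V c *m M) 1%:M u.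

Definition trprod V (ws : seq (seq nat)) : R := \prod_(v <- ws) \tr (word V v).

Lemma letter_W V c : is_W c -> letter V c = V.
Proof. by move: c => [|[|[|c]]]. Qed.

Lemma letter_noW V V' c : ~~ is_W c -> letter V c = letter V' c.
Proof. by move: c => [|[|[|c]]]. Qed.

Lemma word_cons V c u : word V (c :: u) = letter V c *m word V u.
Proof. by []. Qed.

Lemma word_cat V u v : word V (u ++ v) = word V u *m word V v.
Proof. by elim: u => [|c u IH] /=; rewrite ?mul1mx// IH mulmxA. Qed.

Lemma word_rcons V u c : word V (rcons u c) = word V u *m letter V c.
Proof. by rewrite -cats1 word_cat /= mulmx1. Qed.

Lemma word_rev V u : V^T = V -> word V (rev u) = (word V u)^T.
Proof.
move=> VT; elim: u => [|c u IH] /=; first by rewrite trmx1.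
rewrite rev_cons word_rcons IH trmx_mul; congr (_ *m _).
by move: c => [|[|[|c]]] /=.
Qed.

Lemma trprod_cons V v ws : trprod V (v :: ws) = \tr (word V v) * trprod V ws.
Proof. by rewrite /trprod big_cons. Qed.

Lemma trprod_cat V ws ws' : trprod V (ws ++ ws') = trprod V ws * trprod V ws'.
Proof. by rewrite /trprod big_cat. Qed.

Variable Y : 'M[R]_(p, n).
Local Notation V := (Y *m Y^T).

Let VT : V^T = V.
Proof. by rewrite trmx_mul trmxK. Qed.

Definition dgram (a : 'I_p) (j : 'I_n) : 'M[R]_p :=
  Sigma *m delta_mx a j *m Y^T + Y *m (Sigma *m delta_mx a j)^T.

Definition dletter a j (c : nat) : 'M[R]_p := if is_W c then dgram a j else 0.

Fixpoint dword a j (u : seq nat) : 'M[R]_p :=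
  if u is c :: u' then dletter a j c *m word V u' + letter V c *m dword a j u' else 0.

Fixpoint dtrprod a j (ws : seq (seq nat)) : R :=
  if ws is v :: ws' then
    \tr (dword a j v) * trprod V ws' + \tr (word V v) * dtrprod a j ws'
  else 0.

Let sum_entries m q (M : 'M[R]_(m, q)) (N : 'M[R]_(q, m)) :
  \sum_i \sum_j M i j * N j i = \tr (M *m N).
Proof. by apply: eq_bigr => i _; rewrite mxE. Qed.

(** An elementary matrix has rank one, so entries and traces of products containing it factor;
    summing over a and j then reassembles the factors into one product. *)
Let entry_delta m q (M : 'M[R]_(m, p)) (N : 'M[R]_(n, q)) a j i k :
  (M *m delta_mx a j *m N) i k = M i a * N j k.
Proof.
rewrite mxE (bigD1 j)//= big1 ?addr0; last first.
  move=> l lj; rewrite mxE big1 ?mul0r// => l' _.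
  by rewrite mxE (negPf lj) andbF mulr0.
rewrite mxE (bigD1 a)//= big1 ?addr0; last first.
  by move=> l /negPf la; rewrite mxE la mulr0.
by rewrite mxE !eqxx mulr1.
Qed.

Let entry_deltaT m q (M : 'M[R]_(m, n)) (N : 'M[R]_(p, q)) a j i k :
  (M *m (delta_mx a j)^T *m N) i k = M i j * N a k.
Proof.
rewrite trmx_delta mxE (bigD1 a)//= big1 ?addr0; last first.
  move=> l la; rewrite mxE big1 ?mul0r// => l' _.
  by rewrite mxE (negPf la) andbF mulr0.
rewrite mxE (bigD1 j)//= big1 ?addr0; last first.
  by move=> l /negPf lj; rewrite mxE lj mulr0.
by rewrite mxE !eqxx mulr1.
Qed.

Let tr_delta m (M : 'M[R]_(m, p)) (N : 'M[R]_(n, m)) a j :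
  \tr (M *m delta_mx a j *m N) = (N *m M) j a.
Proof.
rewrite mxtrace_mulC mulmxA -[_ *m delta_mx a j]mulmx1 /mxtrace.
under eq_bigr do rewrite entry_delta.
rewrite (bigD1 j)//= big1 ?addr0; last first.
  by move=> l /negPf lj; rewrite [X in _ * X]mxE eq_sym lj mulr0.
by rewrite [X in _ * X]mxE eqxx mulr1.
Qed.

Let tr_deltaT m (M : 'M[R]_(m, n)) (N : 'M[R]_(p, m)) a j :
  \tr (M *m (delta_mx a j)^T *m N) = (N *m M) a j.
Proof.
rewrite mxtrace_mulC mulmxA -[_ *m (delta_mx a j)^T]mulmx1 /mxtrace.
under eq_bigr do rewrite entry_deltaT.
rewrite (bigD1 a)//= big1 ?addr0; last first.
  by move=> l /negPf la; rewrite [X in _ * X]mxE eq_sym la mulr0.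
by rewrite [X in _ * X]mxE eqxx mulr1.
Qed.

(** For an occurrence X W U the derivative of W is Sigma E Y' + Y E' Sigma, with E elementary. The
    first part sums to tr(Y' X Sigma U' Y), where the transpose U' is the reversed word; the second
    splits into the two traces tr(Y' X Y) and tr(Sigma U). *)
Lemma sum_dword pre u :
  \sum_a \sum_j (Y^T *m word V pre *m dword a j u) j a =
  \sum_(x <- splits pre u) (\tr (word V (3 :: x.1 ++ 0 :: rev x.2)%N) +
     \tr (word V (3 :: x.1)%N) * \tr (word V (0 :: x.2)%N)).
Proof.
elim: u pre => [|c u IH] pre /=.
  by rewrite big_nil big1// => a _; rewrite big1// => j _; rewrite mulmx0 mxE.
transitivity (\sum_a \sum_j (Y^T *m word V pre *m (dletter a j c *m word V u)) j a +
   \sum_a \sum_j (Y^T *m word V (rcons pre c) *m dword a j u) j a).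
  rewrite -big_split; apply: eq_bigr => a _; rewrite -big_split; apply: eq_bigr => j _ /=.
  by rewrite mulmxDr mxE word_rcons !mulmxA.
rewrite IH /dletter; case: ifPn => cW; last first.
  rewrite [X in X + _]big1 ?add0r// => a _; rewrite big1// => j _.
  by rewrite mul0mx mulmx0 mxE.
rewrite big_cons; congr (_ + _) => {IH} /=.
set X := word V pre; set U := word V u.
transitivity (\sum_a \sum_j ((Y^T *m X *m Sigma) j a * (U^T *m Y) a j) +
  \sum_a \sum_j ((Y^T *m X *m Y) j j * (Sigma *m U) a a)).
  rewrite -big_split; apply: eq_bigr => a _; rewrite -big_split; apply: eq_bigr => j _ /=.
  rewrite /dgram mulmxDl mulmxDr mxE; congr (_ + _).
    rewrite !mulmxA -(mulmxA _ Y^T) entry_delta; congr (_ * _).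
    transitivity ((Y^T *m U)^T a j); first by rewrite [RHS]mxE.
    by rewrite trmx_mul trmxK.
  by rewrite trmx_mul SigmaT !mulmxA -(mulmxA _ Sigma) entry_deltaT.
congr (_ + _).
  rewrite exchange_big /= sum_entries word_cat word_cons word_rev//=.
  by rewrite -/X -/U mxtrace_mulC !mulmxA [in RHS]mxtrace_mulC !mulmxA.
transitivity (\sum_a \tr (Y^T *m X *m Y) * (Sigma *m U) a a).
  by apply: eq_bigr => a _; rewrite -big_distrl.
by rewrite -big_distrr /= -/X -/U [in LHS]mxtrace_mulC !mulmxA.
Qed.

(** Here the W sits in another trace tr(X W U). Differentiating opens that cycle at W, and the sum
    over a and j glues it into tr(W u), once reversed and once in its own direction, according to
    which factor of W = Y Y' is hit. *)
Lemma sum_dword_trace u pre v :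
  \sum_a \sum_j (Y^T *m word V u) j a * \tr (word V pre *m dword a j v) =
  \sum_(x <- splits pre v) (\tr (word V (3 :: u ++ 0 :: rev x.1 ++ rev x.2)%N) +
     \tr (word V (3 :: u ++ 0 :: x.2 ++ x.1)%N)).
Proof.
elim: v pre => [|c v IH] pre /=.
  by rewrite big_nil big1// => a _; rewrite big1// => j _; rewrite mulmx0 linear0 mulr0.
transitivity (\sum_a \sum_j (Y^T *m word V u) j a *
     \tr (word V pre *m (dletter a j c *m word V v)) +
   \sum_a \sum_j (Y^T *m word V u) j a * \tr (word V (rcons pre c) *m dword a j v)).
  rewrite -big_split; apply: eq_bigr => a _; rewrite -big_split; apply: eq_bigr => j _ /=.
  by rewrite mulmxDr linearD /= mulrDr word_rcons !mulmxA.
rewrite IH /dletter; case: ifPn => cW; last first.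
  rewrite [X in X + _]big1 ?add0r// => a _; rewrite big1// => j _.
  by rewrite mul0mx mulmx0 linear0 mulr0.
rewrite big_cons; congr (_ + _) => {IH} /=.
set X := word V pre; set U := word V v; set Z := Y^T *m word V u.
transitivity (\sum_a \sum_j (Z j a * (Y^T *m U *m X *m Sigma)^T a j) +
  \sum_a \sum_j (Z j a * (Sigma *m U *m X *m Y) a j)).
  rewrite -big_split; apply: eq_bigr => a _; rewrite -big_split; apply: eq_bigr => j _ /=.
  rewrite -mulrDr; congr (_ * _).
  rewrite /dgram mulmxDl mulmxDr linearD /=; congr (_ + _).
    by rewrite !mulmxA -(mulmxA _ Y^T) tr_delta [RHS]mxE !mulmxA.
  by rewrite trmx_mul SigmaT !mulmxA -(mulmxA _ Sigma) tr_deltaT !mulmxA.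
congr (_ + _); rewrite exchange_big /= sum_entries /Z.
  rewrite !trmx_mul SigmaT trmxK word_cat word_cons word_cat !word_rev//=.
  by rewrite -/X -/U !mulmxA mxtrace_mulC !mulmxA.
by rewrite word_cat word_cons word_cat /= -/X -/U !mulmxA mxtrace_mulC !mulmxA.
Qed.

Lemma sum_dtrprod u acc ws :
  \sum_a \sum_j (Y^T *m word V u) j a * (trprod V acc * dtrprod a j ws) =
  \sum_(st <- hterms u acc ws) trprod V st.
Proof.
elim: ws acc => [|v ws IH] acc /=.
  by rewrite big_nil big1// => a _; rewrite big1// => j _; rewrite !mulr0.
rewrite big_cat /= -IH big_flatten /= big_map.
transitivity (\sum_a \sum_j (Y^T *m word V u) j a * \tr (word V [::] *m dword a j v) *
     (trprod V acc * trprod V ws) +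
   \sum_a \sum_j (Y^T *m word V u) j a * (trprod V (v :: acc) * dtrprod a j ws)).
  rewrite -big_split; apply: eq_bigr => a _; rewrite -big_split; apply: eq_bigr => j _ /=.
  by rewrite mul1mx trprod_cons; ring.
congr (_ + _).
transitivity ((\sum_a \sum_j (Y^T *m word V u) j a * \tr (word V [::] *m dword a j v)) *
    (trprod V acc * trprod V ws)).
  by rewrite mulr_suml; apply: eq_bigr => a _; rewrite mulr_suml.
rewrite sum_dword_trace big_distrl /=; apply: eq_bigr => x _.
by rewrite !big_cons big_nil !trprod_cons !trprod_cat addr0 mulrDl.
Qed.

Lemma sum_wterms u ws :
  \sum_a \sum_j (Y^T *m dword a j u) j a * trprod V ws =
  \sum_(st <- wterms u ws) trprod V st.
Proof.
under eq_bigr do rewrite -big_distrl/=.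
rewrite -big_distrl /=.
have -> : \sum_a \sum_j (Y^T *m dword a j u) j a =
    \sum_a \sum_j (Y^T *m word V [::] *m dword a j u) j a.
  by apply: eq_bigr => a _; apply: eq_bigr => j _; rewrite mulmx1.
rewrite sum_dword /wterms big_flatten /= big_map big_distrl /=; apply: eq_bigr => x _.
by rewrite !big_cons big_nil !trprod_cons addr0 mulrDl mulrA.
Qed.

(** The leading Y is contracted with the Y' of the same W; each of the n columns contributes
    tr(Sigma U), which is where the factor n comes from. *)
Lemma sum_dfirst u ws :
  \sum_(a < p) \sum_(j < n)
    ((Sigma *m @delta_mx R p n a j)^T *m word V u) j a * trprod V ws =
  n%:R * trprod V ((0 :: u) :: ws)%N.
Proof.
transitivity (\sum_a \sum_(j < n) (Sigma *m word V u) a a * trprod V ws).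
  apply: eq_bigr => a _; apply: eq_bigr => j _; congr (_ * _).
  rewrite trmx_mul SigmaT -mulmxA -[_^T *m _]mul1mx mulmxA entry_deltaT.
  by rewrite mxE eqxx mul1r.
under eq_bigr do rewrite sumr_const card_ord -mulr_natl.
by rewrite -big_distrr /= -big_distrl /= trprod_cons.
Qed.

Lemma trprod_entries u ws :
  trprod V ((3 :: u) :: ws)%N =
  \sum_a \sum_j Y a j * ((Y^T *m word V u) j a * trprod V ws).
Proof.
rewrite trprod_cons /= -mulmxA -sum_entries big_distrl /=.
apply: eq_bigr => a _; rewrite big_distrl /=.
by apply: eq_bigr => j _; rewrite mulrA.
Qed.

End words.

(** * The recursion for products of traces *)

Section haff.
Context {R : realType} d (T : measurableType d) (P : probability T R).
Context (p n : nat) (Sigma A B : 'M[R]_p) (y : 'I_n -> {RV P >-> 'cV[R]_p}).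
Hypothesis hS : is_covariance_mx Sigma.
Hypotheses (AT : A^T = A) (BT : B^T = B).
Hypothesis indep : independent_RVs y.
Hypothesis hy : forall j, is_mvnormal 0 Sigma (y j).
Local Notation mean := (Rmean P).
Local Notation moments := (moments P).
Local Notation Y := (ymx y).
Local Notation poly_pair := (poly_pair Sigma y).
Local Notation mx_pair := (mx_pair Sigma y).
Local Notation word := (word Sigma A B).
Local Notation trprod := (trprod Sigma A B).

Let SigmaT : Sigma^T = Sigma. Proof. by case: hS. Qed.

Definition gram (w : T) : 'M[R]_p := Y w *m (Y w)^T.

Let mx_pair_word u :
  mx_pair (fun w => word (gram w) u) (fun a j w => dword Sigma A B (Y w) a j u).
Proof.
elim: u => [|c u IH] /=; first exact: mx_pair_cst.
have hc : mx_pair (fun w => letter Sigma A B (gram w) c)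
    (fun a j w => dletter Sigma (Y w) a j c).
  rewrite /dletter; case: (boolP (is_W c)) => cW.
    under eq_fun do rewrite letter_W//.
    have hY := mx_pair_ymx y hS.
    exact: (mx_pairM hY (mx_pair_tr hY)).
  (* A letter other than W ignores its matrix argument, so 0 serves as a placeholder. *)
  have -> : (fun w => letter Sigma A B (gram w) c) = (fun=> letter Sigma A B 0 c).
    by apply/funext => w; exact: letter_noW.
  exact: mx_pair_cst.
exact: (mx_pairM hc IH).
Qed.

Let poly_pair_trprod ws :
  poly_pair (fun w => trprod (gram w) ws) (fun a j w => dtrprod Sigma A B (Y w) a j ws).
Proof.
elim: ws => [|v ws IH] /=.
  by apply: (poly_pair_ext _ _ (poly_pair_cst Sigma y 1)) => *; rewrite // /trprod big_nil.
apply: (poly_pair_ext _ _ (poly_pairM (mx_pair_trace (mx_pair_word v)) IH)) => //.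
by move=> w; rewrite trprod_cons.
Qed.

Lemma moments_trprod ws : moments (fun w => trprod (gram w) ws).
Proof. exact: (poly_pair_moments hS hy (poly_pair_trprod ws)). Qed.

Lemma mean_trprod u ws :
  mean (fun w => trprod (gram w) ((3 :: u) :: ws)%N) =
  n%:R * mean (fun w => trprod (gram w) ((0 :: u) :: ws)%N) +
  \sum_(st <- wterms u ws ++ hterms u [::] ws) mean (fun w => trprod (gram w) st).
Proof.
pose F a j w := ((Y w)^T *m word (gram w) u) j a * trprod (gram w) ws.
(* The derivative of the cofactor [F a j] of the entry Y(a, j): it hits the Y' of the leading W, the
   word [u], or the remaining traces. Only a' = a and j' = j enter the sum. *)
pose G a j a' j' w :=
  ((Sigma *m delta_mx a' j')^T *m word (gram w) u +
   (Y w)^T *m dword Sigma A B (Y w) a' j' u) j a * trprod (gram w) ws +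
  ((Y w)^T *m word (gram w) u) j a * dtrprod Sigma A B (Y w) a' j' ws.
have hFG a j : poly_pair (F a j) (G a j).
  have hY := mx_pair_tr (mx_pair_ymx y hS).
  exact: (poly_pairM (mx_pairM hY (mx_pair_word u) j a) (poly_pair_trprod ws)).
transitivity (mean (fun w => \sum_a \sum_j Y w a j * F a j w)).
  by congr (mean _); apply/funext => w; rewrite trprod_entries.
have mF a j : moments (fun w => Y w a j * F a j w).
  under eq_fun do rewrite mxE; apply: momentsM; first exact: (moments_entry hS hy).
  exact: (poly_pair_moments hS hy (hFG a j)).
have mG a j : moments (G a j a j) by exact: (poly_pair_momentsd hS hy a j (hFG a j)).
rewrite mean_sum; last by move=> a _; apply: moments_sum.
transitivity (mean (fun w => \sum_a \sum_j G a j a j w)).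
  rewrite [RHS]mean_sum; last by move=> a _; apply: moments_sum.
  apply: eq_bigr => a _; rewrite !mean_sum//; apply: eq_bigr => j _.
  under eq_fun do rewrite mxE.
  exact: (poly_pair_stein hS indep hy a j (hFG a j)).
transitivity (mean (fun w => n%:R * trprod (gram w) ((0 :: u) :: ws)%N +
   \sum_(st <- wterms u ws ++ hterms u [::] ws) trprod (gram w) st)).
  congr (mean _); apply/funext => w.
  transitivity (\sum_(a < p) \sum_(j < n)
     ((Sigma *m @delta_mx R p n a j)^T *m word (gram w) u) j a * trprod (gram w) ws +
    (\sum_a \sum_j ((Y w)^T *m dword Sigma A B (Y w) a j u) j a * trprod (gram w) ws +
    \sum_a \sum_j ((Y w)^T *m word (gram w) u) j a *
       (trprod (gram w) [::] * dtrprod Sigma A B (Y w) a j ws))).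
    rewrite -!big_split; apply: eq_bigr => a _; rewrite -!big_split; apply: eq_bigr => j _ /=.
    by rewrite /G mxE /trprod big_nil; ring.
  rewrite (sum_dfirst _ _ SigmaT) (sum_wterms SigmaT AT BT) (sum_dtrprod SigmaT AT BT).
  by rewrite big_cat.
rewrite meanD; [|by apply: momentsZ; exact: moments_trprod|]; last first.
  by apply: moments_sum => st _; exact: moments_trprod.
by rewrite meanZ ?mean_sum// => *; exact: moments_trprod.
Qed.

End haff.

(** * Normal forms of words, and the recursion as a program *)

Fixpoint lexle (u v : seq nat) : bool :=
  match u, v with
  | [::], _ => true
  | _, [::] => false
  | a :: u', b :: v' => if (a < b)%N then true else if (b < a)%N then false else lexle u' v'
  end.

Definition rotations (v : seq nat) := [seq rot i v | i <- iota 0 (size v)].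

(** A common representative for words equal up to rotation and reversal, so that equal traces are
    merged. Soundness rests only on the result being one of these words, not on properties of the
    order. *)
Definition canon (v : seq nat) : seq nat :=
  foldr (fun x z => if lexle x z then x else z) v (rotations v ++ rotations (rev v)).

Definition normal_state (ws : seq (seq nat)) := sort lexle (map canon ws).

(* Linear combinations pair each product of traces with its coefficient, a
   polynomial in n given by the list of its coefficients in increasing degree. *)
Fixpoint addp (q r : seq nat) : seq nat :=
  match q, r with
  | [::], _ => r
  | _, [::] => q
  | a :: q', b :: r' => (a + b)%N :: addp q' r'
  end.

Notation state := (seq (seq nat)).

Fixpoint insert_term (st : state) (q : seq nat) (l : seq (state * seq nat)) :=
  if l is x :: l' then
    if st == x.1 then (x.1, addp q x.2) :: l' else x :: insert_term st q l'
  else [:: (st, q)].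

Fixpoint pick_W (acc ws : state) : option (seq nat * state) :=
  if ws is v :: ws' then
    if has is_W v then Some (v, acc ++ ws') else pick_W (v :: acc) ws'
  else None.

Definition reduce_term (st : state) (q : seq nat) l :=
  if pick_W [::] st is Some (v, rest) then
    (* The trace is rotated to begin with W, and that W is dropped. *)
    let u := behead (rot (find is_W v) v) in
    foldr (fun s l => insert_term (normal_state s) q l)
      (* Prepending 0 to the coefficient list multiplies the polynomial by n. *)
      (insert_term (normal_state ((0 :: u) :: rest)%N) (0%N :: q) l)
      (wterms u rest ++ hterms u [::] rest)
  else insert_term st q l.

Definition reduce (c : seq (state * seq nat)) :=
  foldr (fun x l => reduce_term x.1 x.2 l) [::] c.

Definition no_W (st : state) := ~~ has (has is_W) st.

(** * Soundness of the program *)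

Section reflection.
Context {R : comNzRingType} (p n : nat) (Sigma A B : 'M[R]_p).
Hypotheses (SigmaT : Sigma^T = Sigma) (AT : A^T = A) (BT : B^T = B).
Local Notation word := (word Sigma A B).
Local Notation trprod := (trprod Sigma A B).

Lemma trace_rot V i v : \tr (word V (rot i v)) = \tr (word V v).
Proof. by rewrite /rot word_cat mxtrace_mulC -word_cat cat_take_drop. Qed.

Lemma trace_canon V v : V^T = V -> \tr (word V (canon v)) = \tr (word V v).
Proof.
move=> VT; rewrite /canon.
have : forall x, x \in rotations v ++ rotations (rev v) -> \tr (word V x) = \tr (word V v).
  move=> x; rewrite mem_cat => /orP[] /mapP[i _ ->]; first exact: trace_rot.
  by rewrite trace_rot word_rev// mxtrace_tr.
elim: (_ ++ _) => //= x s IH h.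
case: ifP => _; first by apply: h; rewrite mem_head.
by apply: IH => z zs; apply: h; rewrite in_cons zs orbT.
Qed.

Lemma trprod_perm V ws ws' : perm_eq ws ws' -> trprod V ws = trprod V ws'.
Proof. by move=> h; rewrite /trprod (perm_big _ h). Qed.

Lemma trprod_normal V ws : V^T = V -> trprod V (normal_state ws) = trprod V ws.
Proof.
move=> VT; rewrite (@trprod_perm _ _ (map canon ws)); last by rewrite perm_sort.
by rewrite /trprod big_map; apply: eq_bigr => v _; exact: trace_canon.
Qed.

Lemma pick_WP V acc ws v rest : pick_W acc ws = Some (v, rest) ->
  has is_W v /\ trprod V (acc ++ ws) = trprod V (v :: rest).
Proof.
elim: ws acc => //= z ws IH acc; case: ifPn => [zW [<- <-]|_ /IH[vW <-]].
  by split=> //; apply: trprod_perm; rewrite -cat1s perm_catCA.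
by split=> //; apply: trprod_perm; rewrite /= -cat1s perm_catCA.
Qed.

Lemma rot_W V v : has is_W v ->
  \tr (word V v) = \tr (word V (3 :: behead (rot (find is_W v) v))%N).
Proof.
move=> vW; rewrite -(trace_rot V (find is_W v) v) /rot.
rewrite (drop_nth 0%N) -?has_find// /= letter_W//.
exact: nth_find.
Qed.

Lemma trprod_no_W V V' ws : no_W ws -> trprod V ws = trprod V' ws.
Proof.
rewrite /no_W => /hasPn h; rewrite /trprod big_seq [RHS]big_seq.
apply: eq_bigr => v /h /hasPn {h}; elim: v => //= c v IH h.
have -> : word V v = word V' v.
  have : {in v, forall x, ~~ is_W x} by move=> x xv; apply: h; rewrite in_cons xv orbT.
  elim: v {IH h} => //= e v IH h; rewrite (letter_noW _ _ _ V V') ?h ?mem_head//.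
  by rewrite IH// => x xv; apply: h; rewrite in_cons xv orbT.
by rewrite (letter_noW _ _ _ V V')// h// mem_head.
Qed.

Definition evalp (q : seq nat) : R := foldr (fun c x => c%:R + n%:R * x) 0 q.

Lemma evalp_addp q r : evalp (addp q r) = evalp q + evalp r.
Proof.
elim: q r => [|a q IH] [|b r] /=; rewrite ?add0r ?addr0//.
by rewrite IH natrD; ring.
Qed.

(** The functional [mu], later the mean over Gram matrices, stays abstract: probability meets the
    program only through [mu_eq] and [mu_W]. In [mu_eq] symmetric matrices suffice, and symmetry is
    what reversal of words requires. *)
Definition evalc (mu : state -> R) (c : seq (state * seq nat)) : R :=
  \sum_(x <- c) evalp x.2 * mu x.1.

Lemma evalc_insert mu st q l : evalc mu (insert_term st q l) = evalp q * mu st + evalc mu l.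
Proof.
rewrite /evalc; elim: l => [|x l IH] /=; first by rewrite big_seq1 big_nil addr0.
case: eqP => [->|_]; first by rewrite !big_cons /= evalp_addp; ring.
by rewrite !big_cons IH; ring.
Qed.

Variable mu : state -> R.
Hypothesis mu_eq : forall ws ws',
  (forall V, V^T = V -> trprod V ws = trprod V ws') -> mu ws = mu ws'.
Hypothesis mu_W : forall u ws, mu ((3 :: u) :: ws)%N =
  n%:R * mu ((0 :: u) :: ws)%N + \sum_(st <- wterms u ws ++ hterms u [::] ws) mu st.

Lemma evalc_reduce_term st q l :
  evalc mu (reduce_term st q l) = evalp q * mu st + evalc mu l.
Proof.
rewrite /reduce_term; case E : (pick_W [::] st) => [[v rest]|]; last exact: evalc_insert.
set u := behead _.
have -> : mu st = mu ((3 :: u) :: rest)%N.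
  apply: mu_eq => V _; have [vW /= ->] := pick_WP V E.
  by rewrite !trprod_cons -rot_W.
rewrite mu_W mulrDr big_distrr /=.
have hn ws : mu (normal_state ws) = mu ws.
  by apply: mu_eq => V VT; rewrite trprod_normal.
elim: (_ ++ _) => [|s ts IH] /=.
  by rewrite big_nil evalc_insert hn /=; ring.
by rewrite evalc_insert IH hn big_cons; ring.
Qed.

Lemma evalc_reduce c : evalc mu (reduce c) = evalc mu c.
Proof.
elim: c => //= x c IH; rewrite evalc_reduce_term IH.
by rewrite /evalc big_cons.
Qed.

(** Valid for every number of rounds; whether W has been eliminated is tested afterwards on the
    output. *)
Lemma evalc_iter_reduce k st :
  mu st = evalc mu (iter k reduce [:: (st, [:: 1%N])]).
Proof.
elim: k => [|k IH]; last by rewrite iterS evalc_reduce.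
by rewrite /evalc big_seq1 /= mulr0 addr0 mul1r.
Qed.

End reflection.

(** * Moments of the Wishart distribution *)

Lemma measurable_mx (R : realType) d (T : measurableType d) (m n : nat) (f : T -> 'M[R]_(m, n)) :
  (forall i j, measurable_fun setT (fun w => f w i j)) -> measurable_fun setT f.
Proof.
move=> h; apply: measurability => //.
move=> _ [_ [ij _ [U mU <-]] <-]; rewrite !setTI.
by have := h ij.1 ij.2 measurableT U mU; rewrite setTI.
Qed.

Lemma measurable_trprod (R : realType) (p : nat) (Sigma A B : 'M[R]_p) ws :
  measurable_fun setT (fun M : 'M[R]_p => trprod Sigma A B M ws).
Proof.
have hw u i j : measurable_fun setT (fun M : 'M[R]_p => word Sigma A B M u i j).
  elim: u i j => [|c u IH] i j /=; first exact: measurable_cst.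
  under eq_fun do rewrite mxE.
  apply: measurable_sum => k; apply: measurable_funM => //.
  move: c => [|[|[|c]]] /=; try exact: measurable_cst.
  exact: measurable_mx_entry.
by apply: measurable_prod => v _; apply: measurable_sum.
Qed.

Lemma wishart_expectation (R : realType) (p n : nat) (Sigma : 'M[R]_p)
    (hSigma : is_covariance_mx Sigma)
    (d : measure_display) (T : measurableType d) (P : probability T R)
    (W : {RV P >-> 'M[R]_p}) (hW : is_wishart n Sigma (distribution P W))
    (A B : 'M[R]_p) (hA : A^T = A) (hB : B^T = B) (st : state) (k : nat) c :
  iter k reduce [:: (st, [:: 1%N])] = c -> all (fun x => no_W x.1) c ->
  'E_P[fun w => trprod Sigma A B (W w) st]%E =
    (\sum_(x <- c) evalp n x.2 * trprod Sigma A B 0 x.1)%:E.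
Proof.
move=> hc noW; have [d' [T' [P' [y [indep hy hmu]]]]] := hW.
pose f M := trprod Sigma A B M st.
have mf : measurable_fun setT f by exact: measurable_trprod.
have gramE w : gram y w = \sum_(j < n) y j w *m (y j w)^T.
  apply/matrixP => i i'; rewrite summxE mxE; apply: eq_bigr => j _.
  by rewrite !mxE big_ord1 !mxE.
have mX : measurable_fun setT (gram y).
  apply: measurable_mx => i i'.
  have -> : (fun w => gram y w i i') = (fun w => \sum_j y j w i 0 * y j w i' 0).
    by apply/funext => w; rewrite mxE; apply: eq_bigr => j _; rewrite !mxE.
  apply: measurable_sum => j; apply: measurable_funM.
    by apply: (measurableT_comp (measurable_mx_entry i 0)).
  by apply: (measurableT_comp (measurable_mx_entry i' 0)).
(* As a random variable the Gram matrix has a law that is a measure, through which the expectation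
   passes from the space of [W] to that of the vectors. *)
pose X : {RV P' >-> 'M[R]_p} := HB.pack (gram y) (isMeasurableFun.Build _ _ _ _ _ mX).
have mo ws : moments P' (fun w => trprod Sigma A B (gram y w) ws).
  exact: moments_trprod.
have hXW U : measurable U -> pushforward P W U = distribution P' X U.
  by move=> mU; rewrite [LHS]hmu// /distribution /pushforward; congr (P' _);
    apply/seteqP; split=> w /=; rewrite gramE.
have intf : (distribution P' X).-integrable setT (EFin \o f).
  apply: integrable_pushforward => //; first exact/measurable_EFinP.
  exact: (moments_integrable (mo st)).
rewrite unlock (integral_law _ hXW mf intf)//.
rewrite -(@integral_law _ _ _ _ _ P' _ mX (distribution P' X) _ _ mf intf)//.
have := expectation_mean (mo st); rewrite unlock => ->; congr EFin.
pose mu ws := Rmean P' (fun w => trprod Sigma A B (gram y w) ws).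
have mu_eq ws ws' : (forall V, V^T = V -> trprod Sigma A B V ws = trprod Sigma A B V ws') ->
    mu ws = mu ws'.
  move=> h; rewrite /mu; congr (Rmean P' _); apply/funext => w; apply: h.
  by rewrite trmx_mul trmxK.
have SigmaT : Sigma^T = Sigma by case: hSigma.
rewrite -[LHS]/(mu st) (evalc_iter_reduce SigmaT hA hB mu_eq (n := n) _ k); last first.
  by move=> u ws; exact: (mean_trprod hSigma hA hB indep hy).
rewrite hc /evalc big_seq [RHS]big_seq; apply: eq_bigr => x xc; congr (_ * _).
(* No W is left, so the product of traces is constant and may be evaluated at the matrix 0. *)
rewrite /mu -[RHS](mean_cst P'); congr (Rmean P' _); apply/funext => w.
by apply: trprod_no_W; exact: (allP noW).
Qed.

(** * Reading the output of the program as traces *)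

Section evaluation.
Context {R : comNzRingType} (p : nat) (Sigma A B : 'M[R]_p).

Lemma trprodE V ws :
  trprod Sigma A B V ws = foldr (fun v r => \tr (word Sigma A B V v) * r) 1 ws.
Proof. by elim: ws => [|v ws IH]; rewrite /trprod ?big_nil// big_cons /= -IH. Qed.

Definition trword (v : seq nat) : R := \tr (word Sigma A B 0 v).

Lemma evalcE n (c : seq (state * seq nat)) :
  \sum_(x <- c) evalp n x.2 * trprod Sigma A B 0 x.1 =
  foldr (fun x r => evalp n x.2 * foldr (fun v r => trword v * r) 1 x.1 + r) 0 c.
Proof.
by elim: c => [|x c IH]; rewrite ?big_nil// big_cons /= -IH -trprodE.
Qed.

Lemma mx_expr2 (M : 'M[R]_p) : M ^+ 2 = M *m M. Proof. by []. Qed.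
Lemma mx_expr3 (M : 'M[R]_p) : M ^+ 3 = M *m M *m M.
Proof. by rewrite -mulmxA. Qed.
Lemma mx_expr4 (M : 'M[R]_p) : M ^+ 4 = M *m M *m M *m M.
Proof. by rewrite -!mulmxA. Qed.
Lemma mx_expr5 (M : 'M[R]_p) : M ^+ 5 = M *m M *m M *m M *m M.
Proof. by rewrite -!mulmxA. Qed.
Definition mx_expr := (mx_expr2, mx_expr3, mx_expr4, mx_expr5).

End evaluation.

(** The table of words in the form chosen by [canon]: the longest run of Sigma comes first and A
    precedes B. Hence only Sigma^i A Sigma^j B with i >= j is listed. *)
Lemma trwordE (R : realType) (p : nat) (Sigma A B : 'M[R]_p) :
  let t := trword Sigma A B in
  ((t [:: 0]%N = \tr Sigma)
  * (t [:: 0; 0]%N = \tr (Sigma ^+ 2))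
  * (t [:: 0; 0; 0]%N = \tr (Sigma ^+ 3))
  * (t [:: 0; 0; 0; 0]%N = \tr (Sigma ^+ 4))
  * (t [:: 0; 1]%N = \tr (Sigma *m A))
  * (t [:: 0; 0; 1]%N = \tr (Sigma ^+ 2 *m A))
  * (t [:: 0; 0; 0; 1]%N = \tr (Sigma ^+ 3 *m A))
  * (t [:: 0; 0; 0; 0; 1]%N = \tr (Sigma ^+ 4 *m A))
  * (t [:: 0; 0; 0; 0; 0; 1]%N = \tr (Sigma ^+ 5 *m A))
  * (t [:: 0; 2]%N = \tr (Sigma *m B))
  * (t [:: 0; 0; 2]%N = \tr (Sigma ^+ 2 *m B))
  * (t [:: 0; 0; 0; 2]%N = \tr (Sigma ^+ 3 *m B))
  * (t [:: 0; 0; 0; 0; 2]%N = \tr (Sigma ^+ 4 *m B))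
  * (t [:: 0; 0; 0; 0; 0; 2]%N = \tr (Sigma ^+ 5 *m B))
  * (t [:: 0; 1; 0; 2]%N = \tr (Sigma *m A *m Sigma *m B))
  * (t [:: 0; 0; 1; 0; 2]%N = \tr (Sigma ^+ 2 *m A *m Sigma *m B))
  * (t [:: 0; 0; 0; 1; 0; 2]%N = \tr (Sigma ^+ 3 *m A *m Sigma *m B))
  * (t [:: 0; 0; 0; 0; 1; 0; 2]%N = \tr (Sigma ^+ 4 *m A *m Sigma *m B))
  * (t [:: 0; 0; 0; 0; 0; 1; 0; 2]%N = \tr (Sigma ^+ 5 *m A *m Sigma *m B))
  * (t [:: 0; 0; 1; 0; 0; 2]%N = \tr (Sigma ^+ 2 *m A *m Sigma ^+ 2 *m B))
  * (t [:: 0; 0; 0; 1; 0; 0; 2]%N = \tr (Sigma ^+ 3 *m A *m Sigma ^+ 2 *m B))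
  * (t [:: 0; 0; 0; 0; 1; 0; 0; 2]%N = \tr (Sigma ^+ 4 *m A *m Sigma ^+ 2 *m B))
  * (t [:: 0; 0; 0; 1; 0; 0; 0; 2]%N = \tr (Sigma ^+ 3 *m A *m Sigma ^+ 3 *m B)))%type.
Proof. by rewrite /trword /= !mulmx1 !mx_expr !mulmxA. Qed.

(* The state is reduced beforehand by eval, so that the rewritten goal contains
   the explicit list of its terms. *)
Ltac wishart_moment reduceE traceE N st :=
  let c := eval vm_compute in (iter 7 reduce [:: (st, [:: 1%N])]) in
  rewrite (reduceE st c);
  [congr EFin; cbv beta iota delta [evalp foldr fst snd];
   rewrite -/N !traceE; clearbody N;
   repeat match goal with |- context [\tr ?M] => generalize (\tr M); intro end;
   ring
  |by vm_compute
  |by vm_compute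
  |by move=> w; rewrite trprodE /= !mulmx1 ?mulr1 ?mx_expr ?mulmxA].

Theorem lemmaA2 (R : realType) (p n : nat) (Sigma : 'M[R]_p)
    (hSigma : is_covariance_mx Sigma)
    (d : measure_display) (T : measurableType d) (P : probability T R)
    (W : {RV P >-> 'M[R]_p}) (hW : is_wishart n Sigma (distribution P W))
    (A B : 'M[R]_p) (hA : A^T = A) (hB : B^T = B) :
  let N : R := n%:R in
  'E_P[fun w => (\tr (A *m W w) * \tr (B *m W w))%R]%E =
    (N ^+ 2 * \tr (Sigma *m A) * \tr (Sigma *m B)
     + 2 * N * \tr (Sigma *m A *m Sigma *m B))%:E /\
  'E_P[fun w => (\tr (A *m W w *m B *m W w))%R]%E =
    ((N ^+ 2 + N) * \tr (Sigma *m A *m Sigma *m B)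
     + N * \tr (Sigma *m A) * \tr (Sigma *m B))%:E /\
  'E_P[fun w => (\tr (A *m W w ^+ 3))%R]%E =
    ((N ^+ 3 + 3 * N ^+ 2 + 4 * N) * \tr (Sigma ^+ 3 *m A)
     + (N ^+ 2 + N) * \tr (Sigma ^+ 2) * \tr (Sigma *m A)
     + 2 * N * (N + 1) * \tr Sigma * \tr (Sigma ^+ 2 *m A)
     + N * (\tr Sigma) ^+ 2 * \tr (Sigma *m A))%:E /\
  'E_P[fun w => (\tr (A *m W w ^+ 2) * \tr (B *m W w ^+ 2))%R]%E =
    (N * (N ^+ 2 + N + 2) * (N + 1) * \tr (Sigma ^+ 2 *m A) * \tr (Sigma ^+ 2 *m B)
     + (\tr Sigma) ^+ 2 * (
         N ^+ 2 * \tr (Sigma *m A) * \tr (Sigma *m B)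
         + 2 * N * \tr (Sigma *m A *m Sigma *m B))
     + \tr Sigma * (
         N * (N ^+ 2 + N + 2) * \tr (Sigma ^+ 2 *m A) * \tr (Sigma *m B)
         + N * (N ^+ 2 + N + 2) * \tr (Sigma *m A) * \tr (Sigma ^+ 2 *m B)
         + 8 * N * (N + 1) * \tr (Sigma ^+ 2 *m A *m Sigma *m B))
     + \tr (Sigma ^+ 2) * (
         2 * N * \tr (Sigma *m A) * \tr (Sigma *m B)
         + 2 * N * (N + 1) * \tr (Sigma *m A *m Sigma *m B))
     + 4 * N * (N + 1) ^+ 2 * \tr (Sigma ^+ 2 *m A *m Sigma ^+ 2 *m B)
     + 4 * N * (N ^+ 2 + 3 * N + 4) * \tr (Sigma ^+ 3 *m A *m Sigma *m B)
     + 4 * N * (N + 1) * (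
         \tr (Sigma ^+ 3 *m A) * \tr (Sigma *m B)
         + \tr (Sigma *m A) * \tr (Sigma ^+ 3 *m B)))%:E /\
  'E_P[fun w => (\tr (A *m W w ^+ 2 *m B *m W w ^+ 2))%R]%E =
    (2 * N * (N + 1) ^+ 2 * \tr (Sigma ^+ 2 *m A) * \tr (Sigma ^+ 2 *m B)
     + N * (N ^+ 2 + 3 * N + 4) * (N + 1) * \tr (Sigma ^+ 2 *m A *m Sigma ^+ 2 *m B)
     + (\tr Sigma) ^+ 2 * (
         N * \tr (Sigma *m A) * \tr (Sigma *m B)
         + N * (N + 1) * \tr (Sigma *m A *m Sigma *m B))
     + \tr Sigma * (
         2 * N * (N + 1) * (
             \tr (Sigma ^+ 2 *m A) * \tr (Sigma *m B)
             + \tr (Sigma *m A) * \tr (Sigma ^+ 2 *m B))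
         + 2 * N * (N ^+ 2 + 3 * N + 4) * \tr (Sigma ^+ 2 *m A *m Sigma *m B))
     + \tr (Sigma ^+ 2) * (
         N * (N + 1) * \tr (Sigma *m A) * \tr (Sigma *m B)
         + N * (N + 3) * \tr (Sigma *m A *m Sigma *m B))
     + N * (N ^+ 2 + 3 * N + 4) * (
         \tr (Sigma ^+ 3 *m A) * \tr (Sigma *m B)
         + \tr (Sigma *m A) * \tr (Sigma ^+ 3 *m B))
     + 2 * N * (N ^+ 2 + 7 * N + 8) * \tr (Sigma ^+ 3 *m A *m Sigma *m B))%:E /\
  'E_P[fun w => (\tr (A *m W w ^+ 3) * \tr (B *m W w ^+ 3))%R]%E =
    ((N ^+ 2 * \tr (Sigma *m A) * \tr (Sigma *m B)
      + 2 * N * \tr (Sigma *m A *m Sigma *m B)) * (\tr Sigma) ^+ 4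
     + (
         2 * N * (N ^+ 2 + N + 2) * (
             \tr (Sigma *m B) * \tr (Sigma ^+ 2 *m A)
             + \tr (Sigma *m A) * \tr (Sigma ^+ 2 *m B))
         + 16 * N * (N + 1) * \tr (Sigma ^+ 2 *m A *m Sigma *m B)) * (\tr Sigma) ^+ 3
     + (
         2 * N * (N ^+ 2 + N + 4) * \tr (Sigma *m A) * \tr (Sigma *m B)
             * \tr (Sigma ^+ 2)
         + 12 * N * (N + 1) * \tr (Sigma *m A *m Sigma *m B) * \tr (Sigma ^+ 2)
         + 4 * N * (N + 1) * (N ^+ 2 + N + 4) * \tr (Sigma ^+ 2 *m A)
             * \tr (Sigma ^+ 2 *m B)
         + N * (N ^+ 3 + 3 * N ^+ 2 + 24 * N + 20) * (
             \tr (Sigma *m B) * \tr (Sigma ^+ 3 *m A)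
             + \tr (Sigma *m A) * \tr (Sigma ^+ 3 *m B))
         + 4 * N * (5 * N ^+ 2 + 11 * N + 8)
             * \tr (Sigma ^+ 2 *m A *m Sigma ^+ 2 *m B)
         + 24 * N * (N ^+ 2 + 3 * N + 4) * \tr (Sigma ^+ 3 *m A *m Sigma *m B)) * (\tr Sigma) ^+ 2
     + (
         2 * N * (N + 1) * (N ^+ 2 + N + 10) * (
             \tr (Sigma *m B) * \tr (Sigma ^+ 2) * \tr (Sigma ^+ 2 *m A)
             + \tr (Sigma *m A) * \tr (Sigma ^+ 2) * \tr (Sigma ^+ 2 *m B))
         + 2 * N * (N ^+ 4 + 4 * N ^+ 3 + 21 * N ^+ 2 + 38 * N + 32)
             * \tr (Sigma ^+ 3 *m B) * \tr (Sigma ^+ 2 *m A)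
         + 16 * N * (N + 1) * \tr (Sigma *m A) * \tr (Sigma *m B) * \tr (Sigma ^+ 3)
         + 8 * N * (N ^+ 2 + 3 * N + 4) * \tr (Sigma ^+ 3)
             * \tr (Sigma *m A *m Sigma *m B)
         + 2 * N * (N ^+ 4 + 4 * N ^+ 3 + 21 * N ^+ 2 + 38 * N + 32)
             * \tr (Sigma ^+ 2 *m B) * \tr (Sigma ^+ 3 *m A)
         + 16 * N * (2 * N ^+ 2 + 5 * N + 5) * \tr (Sigma ^+ 2)
             * \tr (Sigma ^+ 2 *m A *m Sigma *m B)
         + 4 * N * (7 * N ^+ 2 + 19 * N + 22) * (
             \tr (Sigma *m B) * \tr (Sigma ^+ 4 *m A)
             + \tr (Sigma *m A) * \tr (Sigma ^+ 4 *m B))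
         + 16 * N * (2 * N ^+ 3 + 9 * N ^+ 2 + 21 * N + 16)
             * \tr (Sigma ^+ 3 *m A *m Sigma ^+ 2 *m B)
         + 16 * N * (N ^+ 3 + 6 * N ^+ 2 + 21 * N + 20)
             * \tr (Sigma ^+ 4 *m A *m Sigma *m B)) * \tr Sigma
     + N * (N + 1) * (N ^+ 2 + N + 4) * \tr (Sigma *m A) * \tr (Sigma *m B)
         * (\tr (Sigma ^+ 2)) ^+ 2
     + 4 * N * (5 * N ^+ 2 + 11 * N + 8) * \tr (Sigma ^+ 2) * \tr (Sigma ^+ 2 *m A)
         * \tr (Sigma ^+ 2 *m B)
     + 4 * N * (3 * N ^+ 2 + 7 * N + 6) * (
         \tr (Sigma *m B) * \tr (Sigma ^+ 2 *m A)
         + \tr (Sigma *m A) * \tr (Sigma ^+ 2 *m B)) * \tr (Sigma ^+ 3)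
     + 2 * N * (2 * N ^+ 2 + 5 * N + 5) * (\tr (Sigma ^+ 2)) ^+ 2
         * \tr (Sigma *m A *m Sigma *m B)
     + N * (N ^+ 4 + 4 * N ^+ 3 + 19 * N ^+ 2 + 36 * N + 36) * (
         \tr (Sigma *m B) * \tr (Sigma ^+ 3 *m A)
         + \tr (Sigma *m A) * \tr (Sigma ^+ 3 *m B)) * \tr (Sigma ^+ 2)
     + N * (N ^+ 5 + 6 * N ^+ 4 + 27 * N ^+ 3 + 74 * N ^+ 2 + 156 * N + 120)
         * \tr (Sigma ^+ 3 *m A) * \tr (Sigma ^+ 3 *m B)
     + 4 * N * (2 * N ^+ 2 + 5 * N + 5) * \tr (Sigma *m A) * \tr (Sigma *m B)
         * \tr (Sigma ^+ 4)
     + 2 * N * (N ^+ 3 + 6 * N ^+ 2 + 21 * N + 20) * \tr (Sigma *m A *m Sigma *m B)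
         * \tr (Sigma ^+ 4)
     + 8 * N * (N ^+ 3 + 5 * N ^+ 2 + 14 * N + 12) * \tr (Sigma ^+ 3)
         * \tr (Sigma ^+ 2 *m A *m Sigma *m B)
     + 4 * N * (2 * N ^+ 3 + 9 * N ^+ 2 + 21 * N + 16) * (
         2 * \tr (Sigma ^+ 2 *m B) * \tr (Sigma ^+ 4 *m A)
         + 2 * \tr (Sigma ^+ 2 *m A) * \tr (Sigma ^+ 4 *m B)
         + \tr (Sigma ^+ 2) * \tr (Sigma ^+ 2 *m A *m Sigma ^+ 2 *m B))
     + 12 * N * (N ^+ 3 + 5 * N ^+ 2 + 14 * N + 12) * (
         \tr (Sigma ^+ 2) * \tr (Sigma ^+ 3 *m A *m Sigma *m B)
         + \tr (Sigma *m B) * \tr (Sigma ^+ 5 *m A)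
         + \tr (Sigma *m A) * \tr (Sigma ^+ 5 *m B))
     + 2 * N * (3 * N ^+ 4 + 20 * N ^+ 3 + 77 * N ^+ 2 + 152 * N + 132)
         * \tr (Sigma ^+ 3 *m A *m Sigma ^+ 3 *m B)
     + 8 * N * (N ^+ 4 + 8 * N ^+ 3 + 39 * N ^+ 2 + 80 * N + 64)
         * \tr (Sigma ^+ 4 *m A *m Sigma ^+ 2 *m B)
     + 4 * N * (N ^+ 4 + 10 * N ^+ 3 + 65 * N ^+ 2 + 160 * N + 148)
         * \tr (Sigma ^+ 5 *m A *m Sigma *m B))%:E /\
  'E_P[fun w => (\tr (A *m W w ^+ 3 *m B *m W w ^+ 3))%R]%E =
    (((N ^+ 2 + N) * \tr (Sigma *m A *m Sigma *m B)
      + N * \tr (Sigma *m A) * \tr (Sigma *m B)) * (\tr Sigma) ^+ 4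
     + (
         4 * N * (N + 1) * (
             \tr (Sigma *m B) * \tr (Sigma ^+ 2 *m A)
             + \tr (Sigma *m A) * \tr (Sigma ^+ 2 *m B))
         + 4 * N * (N ^+ 2 + 3 * N + 4) * \tr (Sigma ^+ 2 *m A *m Sigma *m B)) * (\tr Sigma) ^+ 3
     + (
         6 * N * (N + 1) * \tr (Sigma *m A) * \tr (Sigma *m B) * \tr (Sigma ^+ 2)
         + 2 * N * (N ^+ 2 + 4 * N + 7) * \tr (Sigma *m A *m Sigma *m B)
             * \tr (Sigma ^+ 2)
         + 2 * N * (5 * N ^+ 2 + 11 * N + 8) * \tr (Sigma ^+ 2 *m A)
             * \tr (Sigma ^+ 2 *m B)
         + 6 * N * (N ^+ 2 + 3 * N + 4) * (
             \tr (Sigma *m B) * \tr (Sigma ^+ 3 *m A)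
             + \tr (Sigma *m A) * \tr (Sigma ^+ 3 *m B))
         + 2 * N * (2 * N ^+ 3 + 9 * N ^+ 2 + 21 * N + 16)
             * \tr (Sigma ^+ 2 *m A *m Sigma ^+ 2 *m B)
         + 2 * N * (N ^+ 3 + 9 * N ^+ 2 + 42 * N + 44)
             * \tr (Sigma ^+ 3 *m A *m Sigma *m B)) * (\tr Sigma) ^+ 2
     + (
         4 * N * (2 * N ^+ 2 + 5 * N + 5) * (
             \tr (Sigma *m B) * \tr (Sigma ^+ 2 *m A)
             + \tr (Sigma *m A) * \tr (Sigma ^+ 2 *m B)) * \tr (Sigma ^+ 2)
         + 4 * N * (2 * N ^+ 3 + 9 * N ^+ 2 + 21 * N + 16) * (
             \tr (Sigma ^+ 3 *m B) * \tr (Sigma ^+ 2 *m A)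
             + \tr (Sigma ^+ 2 *m B) * \tr (Sigma ^+ 3 *m A))
         + 4 * N * (N ^+ 2 + 3 * N + 4) * \tr (Sigma *m A) * \tr (Sigma *m B)
             * \tr (Sigma ^+ 3)
         + 4 * N * (N ^+ 2 + 7 * N + 8) * \tr (Sigma ^+ 3)
             * \tr (Sigma *m A *m Sigma *m B)
         + 4 * N * (N ^+ 3 + 6 * N ^+ 2 + 21 * N + 20) * (
             \tr (Sigma ^+ 2) * \tr (Sigma ^+ 2 *m A *m Sigma *m B)
             + \tr (Sigma *m B) * \tr (Sigma ^+ 4 *m A)
             + \tr (Sigma *m A) * \tr (Sigma ^+ 4 *m B))
         + 4 * N * (N ^+ 4 + 8 * N ^+ 3 + 39 * N ^+ 2 + 80 * N + 64)
             * \tr (Sigma ^+ 3 *m A *m Sigma ^+ 2 *m B)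
         + 8 * N * (N ^+ 3 + 13 * N ^+ 2 + 40 * N + 42)
             * \tr (Sigma ^+ 4 *m A *m Sigma *m B)) * \tr Sigma
     + N * (2 * N ^+ 2 + 5 * N + 5) * \tr (Sigma *m A) * \tr (Sigma *m B)
         * (\tr (Sigma ^+ 2)) ^+ 2
     + 2 * N * (2 * N ^+ 3 + 9 * N ^+ 2 + 21 * N + 16) * \tr (Sigma ^+ 2)
         * \tr (Sigma ^+ 2 *m A) * \tr (Sigma ^+ 2 *m B)
     + N * (N ^+ 3 + 5 * N ^+ 2 + 14 * N + 12) * (
         2 * (
             \tr (Sigma *m B) * \tr (Sigma ^+ 2 *m A)
             + \tr (Sigma *m A) * \tr (Sigma ^+ 2 *m B)) * \tr (Sigma ^+ 3)
         + 3 * (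
             \tr (Sigma *m B) * \tr (Sigma ^+ 2) * \tr (Sigma ^+ 3 *m A)
             + \tr (Sigma *m A) * \tr (Sigma ^+ 2) * \tr (Sigma ^+ 3 *m B)))
     + N * (N ^+ 3 + 4 * N ^+ 2 + 10 * N + 9) * (\tr (Sigma ^+ 2)) ^+ 2
         * \tr (Sigma *m A *m Sigma *m B)
     + N * (3 * N ^+ 4 + 20 * N ^+ 3 + 77 * N ^+ 2 + 152 * N + 132)
         * \tr (Sigma ^+ 3 *m A) * \tr (Sigma ^+ 3 *m B)
     + N * (N ^+ 3 + 6 * N ^+ 2 + 21 * N + 20) * \tr (Sigma *m A) * \tr (Sigma *m B)
         * \tr (Sigma ^+ 4)
     + N * (N ^+ 3 + 14 * N ^+ 2 + 41 * N + 40) * \tr (Sigma *m A *m Sigma *m B)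
         * \tr (Sigma ^+ 4)
     + 4 * N * (N ^+ 3 + 11 * N ^+ 2 + 28 * N + 24) * \tr (Sigma ^+ 3)
         * \tr (Sigma ^+ 2 *m A *m Sigma *m B)
     + 2 * N * (N ^+ 4 + 8 * N ^+ 3 + 39 * N ^+ 2 + 80 * N + 64) * (
         \tr (Sigma ^+ 2 *m B) * \tr (Sigma ^+ 4 *m A)
         + \tr (Sigma ^+ 2 *m A) * \tr (Sigma ^+ 4 *m B))
     + 2 * N * (2 * N ^+ 3 + 19 * N ^+ 2 + 43 * N + 32) * \tr (Sigma ^+ 2)
         * \tr (Sigma ^+ 2 *m A *m Sigma ^+ 2 *m B)
     + 2 * N * (N ^+ 4 + 7 * N ^+ 3 + 34 * N ^+ 2 + 78 * N + 72) * \tr (Sigma ^+ 2)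
         * \tr (Sigma ^+ 3 *m A *m Sigma *m B)
     + N * (N ^+ 4 + 10 * N ^+ 3 + 65 * N ^+ 2 + 160 * N + 148) * (
         \tr (Sigma *m B) * \tr (Sigma ^+ 5 *m A)
         + \tr (Sigma *m A) * \tr (Sigma ^+ 5 *m B))
     + N * (N ^+ 5 + 9 * N ^+ 4 + 47 * N ^+ 3 + 151 * N ^+ 2 + 308 * N + 252)
         * \tr (Sigma ^+ 3 *m A *m Sigma ^+ 3 *m B)
     + 4 * N * (N ^+ 4 + 16 * N ^+ 3 + 75 * N ^+ 2 + 164 * N + 128)
         * \tr (Sigma ^+ 4 *m A *m Sigma ^+ 2 *m B)
     + 2 * N * (N ^+ 4 + 22 * N ^+ 3 + 125 * N ^+ 2 + 328 * N + 292)
         * \tr (Sigma ^+ 5 *m A *m Sigma *m B))%:E.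
Proof.
move=> N.
(* Each round removes one W from every term that has one. The formulas contain at most six, so seven
   rounds cover them all, and a round without W only merges terms. *)
have reduceE st c F : iter 7 reduce [:: (st, [:: 1%N])] = c ->
    all (fun x => no_W x.1) c -> (forall w, F w = trprod Sigma A B (W w) st) ->
  'E_P[F]%E = (foldr (fun x r => evalp n x.2 *
      foldr (fun v r => trword Sigma A B v * r) 1 x.1 + r) 0 c)%:E.
  move=> h1 h2 /funext ->.
  by rewrite (wishart_expectation hSigma hW hA hB h1 h2) evalcE.
have traceE := trwordE Sigma A B.
split.
  wishart_moment reduceE traceE N ([:: [:: 1; 3]; [:: 2; 3]]%N : state).
split.
  wishart_moment reduceE traceE N ([:: [:: 1; 3; 2; 3]]%N : state).
split.
  wishart_moment reduceE traceE N ([:: [:: 1; 3; 3; 3]]%N : state).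
split.
  wishart_moment reduceE traceE N ([:: [:: 1; 3; 3]; [:: 2; 3; 3]]%N : state).
split.
  wishart_moment reduceE traceE N ([:: [:: 1; 3; 3; 2; 3; 3]]%N : state).
split.
  wishart_moment reduceE traceE N ([:: [:: 1; 3; 3; 3]; [:: 2; 3; 3; 3]]%N : state).
wishart_moment reduceE traceE N ([:: [:: 1; 3; 3; 3; 2; 3; 3; 3]]%N : state).
Qed.
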